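(* Suppose the support $\mathcal W$ of the observed law $P^{\mathrm{obs}}$ of $W=(Y,X)$ is compact. For $b\in\mathcal B$ and $Q=1,2,\dots$ let $\Lambda_{Q,b}$ be the multiplier cones (piecewise linear in $a$, piecewise constant over regressor cells) defined in the context, and let $$\Theta_{I,Q}^{\mathrm{dual}}=\{b\in\mathcal B:\Psi_b(\lambda)\ge0\text{ for every }\lambda\in\Lambda_{Q,b}\}.$$ Suppose that, for every $b\in\mathcal B$, $\Lambda_{Q,b}\subseteq\Lambda_{Q+1,b}$ for every $Q$, and every multiplier in $C_+(\mathcal X\times K_b)^{2T}$ can be approximated uniformly on $\mathcal X\times K_b$, component by component, by elements of $\bigcup_{Q}\Lambda_{Q,b}$. Then, for every $Q\ge1$, $$\Theta_I\subseteq\Theta_{I,Q+1}^{\mathrm{dual}}\subseteq\Theta_{I,Q}^{\mathrm{dual}},\qquad\text{and}\qquad \Theta_I=\bigcap_{Q\ge1}\Theta_{I,Q}^{\mathrm{dual}}.$$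
   Context: $T,k\ge1$ are fixed integers, $\tau\in(0,1)$, $\mathcal B\subseteq\mathbb R^k$. $Y\in\mathbb R^T$, $X=(X_1,\dots,X_T)$, $X_t\in\mathbb R^k$. $\mathcal X$ is the support of $X$. Identified set: $\Theta_I$ is the set of $b\in\mathcal B$ for which there exists a Borel probability law $P^{\mathrm s}$ of $(Y,X,A,U)$, $A\in\mathbb R$, $U\in\mathbb R^T$, with $(Y,X)$-marginal $P^{\mathrm{obs}}$, with $Y_t=X_t'b+A+U_t$ a.s. for all $t$, and with $P^{\mathrm s}(U_t\le0\mid X,A)\ge\tau$, $P^{\mathrm s}(U_t<0\mid X,A)\le\tau$ a.s. for all $t$. Dual functional: $K_b=[\min(y_t-x_t'b),\max(y_t-x_t'b)]$, min and max over $(y,x)\in\mathcal W$, $t\le T$. $C_+$ denotes nonnegative continuous functions. For bounded nonnegative Borel $\lambda=(\lambda_t^-,\lambda_t^+)_{t\le T}$ on $\mathcal X\times K_b$, $$S_b(w,a;\lambda)=\sum_{t=1}^T\big[\lambda_t^-(x,a)\{\mathbf 1(y_t-x_t'b\le a)-\tau\}+\lambda_t^+(x,a)\{\tau-\mathbf 1(y_t-x_t'b<a)\}\big],\quad w=(y,x),$$ $$\Psi_b(\lambda)=E_{P^{\mathrm{obs}}}\big[\max_{a\in K_b}S_b(W,a;\lambda)\big]$$ (for multipliers in $\Lambda_{Q,b}$, which are continuous in $a$, the maximum is attained). Multiplier classes: at resolution $Q$, $\mathcal X$ is partitioned into finitely many Borel cells $D_1^{(Q)},\dots,D_{G_Q}^{(Q)}$,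 and knots $\kappa_0<\dots<\kappa_{L_Q}$ spanning $K_b$ (with $\kappa_0,\kappa_{L_Q}$ the endpoints of $K_b$) are chosen. $B_\ell$ is the piecewise-linear function on $K_b$ equal to $1$ at $\kappa_\ell$ and $0$ at the other knots (if $K_b$ is a singleton, a single constant basis function is used). $\Lambda_{Q,b}$ is the set of all $\lambda$ with $$\lambda_t^\pm(x,a)=\sum_{g=1}^{G_Q}\mathbf 1\{x\in D_g^{(Q)}\}\sum_{\ell=0}^{L_Q}\theta_{tg\ell}^\pm B_\ell(a),\qquad\theta_{tg\ell}^\pm\ge0.$$ *)

(* Defs.v *)
From HB Require Import structures.
From mathcomp Require Import all_boot all_order all_algebra.
From mathcomp Require Import all_classical all_reals all_analysis.

Set Implicit Arguments.
Unset Strict Implicit.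
Unset Printing Implicit Defensive.

Import Order.TTheory GRing.Theory Num.Theory.
Import numFieldNormedType.Exports.

Local Open Scope classical_set_scope.
Local Open Scope ring_scope.

Notation borel E := (g_sigma_algebraType (@open E)).

Definition law_support (R : realType) (E : topologicalType)
    (mu : set E -> \bar R) : set E :=
  [set e | forall U : set E, open U -> U e -> (0 < mu U)%E].

(* [g] is a version of the conditional probability of the event [E] given the
   random element [V], i.e. g(V) is a conditional expectation of 1_E given V. *)
Definition cond_prob_version (R : realType) d d' (Omega : measurableType d)
    (S : measurableType d') (P : probability Omega R) (E : set Omega)
    (V : Omega -> S) (g : S -> R) : Prop :=
  [/\ measurable_fun setT g,
      P.-integrable setT (EFin \o (g \o V)) &
      forall C : set S, measurable C ->
        (\int[P]_(z in V @^-1` C) (g (V z))%:E = P (E `&` V @^-1` C))%E].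

Section Model.
Context (R : realType) (T k : nat).

Local Notation regT := 'M[R]_(T, k).
Local Notation obsT := ('cV[R]_T * 'M[R]_(T, k))%type.
Local Notation condT := ('M[R]_(T, k) * R)%type.
Local Notation fullT := ('cV[R]_T * 'M[R]_(T, k) * R * 'cV[R]_T)%type.

(* w = (y, x), where row t of x is x_t'; the value is y_t - x_t'b. *)
Definition resid (b : 'cV[R]_k) (w : obsT) (t : 'I_T) : R :=
  w.1 t 0 - (w.2 *m b) t 0.

(* A point of [fullT] is z = (y, x, a, u). *)
Definition outcome (z : fullT) : 'cV[R]_T := z.1.1.1.
Definition regressor (z : fullT) : 'M[R]_(T, k) := z.1.1.2.
Definition effect (z : fullT) : R := z.1.2.
Definition disturbance (z : fullT) : 'cV[R]_T := z.2.

Definition observed (z : fullT) : borel obsT := (outcome z, regressor z).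
Definition conditioning (z : fullT) : borel condT := (regressor z, effect z).

(* Versions of a conditional probability exist and are a.s. equal, so an a.s.
   inequality for one version is the same as for all of them. *)
Definition admissible_law (Pobs : probability (borel obsT) R) (tau : R)
    (b : 'cV[R]_k) (Ps : probability (borel fullT) R) : Prop :=
  [/\ forall C : set (borel obsT), measurable C ->
        pushforward Ps observed C = Pobs C,
      forall t : 'I_T, {ae Ps, forall z,
        outcome z t 0 =
          (regressor z *m b) t 0 + effect z + disturbance z t 0},
      forall t : 'I_T, exists2 g : borel condT -> R,
        cond_prob_version Ps [set z | disturbance z t 0 <= 0] conditioning g
        & {ae Ps, forall z, tau <= g (conditioning z)} &
      forall t : 'I_T, exists2 g : borel condT -> R,
        cond_prob_version Ps [set z | disturbance z t 0 < 0] conditioning g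
        & {ae Ps, forall z, g (conditioning z) <= tau}].

Definition identified_set (Pobs : probability (borel obsT) R) (tau : R)
    (B : set 'cV[R]_k) : set 'cV[R]_k :=
  [set b | B b /\
    exists Ps : probability (borel fullT) R, admissible_law Pobs tau b Ps].

Definition obs_support (Pobs : probability (borel obsT) R) : set obsT :=
  law_support Pobs.

Definition reg_support (Pobs : probability (borel obsT) R) : set regT :=
  law_support (pushforward Pobs (snd : borel obsT -> borel regT)).

Definition resid_values (Pobs : probability (borel obsT) R) (b : 'cV[R]_k) :
    set R :=
  [set r | exists w t, obs_support Pobs w /\ r = resid b w t].

(* When the support is compact, this inf and sup are a min and a max. *)
Definition K_lo Pobs b : R := inf (resid_values Pobs b).
Definition K_hi Pobs b : R := sup (resid_values Pobs b).
Definition K_int Pobs b : set R := [set a | K_lo Pobs b <= a <= K_hi Pobs b].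

(* [lam t false] is lambda_t^- and [lam t true] is lambda_t^+; only the values
   for x in the support of X and a in K_b are meaningful. *)
Definition multiplier := 'I_T -> bool -> 'M[R]_(T, k) -> R -> R.

Definition S_dual (tau : R) (b : 'cV[R]_k) (lam : multiplier) (w : obsT)
    (a : R) : R :=
  \sum_(t < T)
    (lam t false w.2 a * ((resid b w t <= a)%R%:R - tau) +
     lam t true w.2 a * (tau - (resid b w t < a)%R%:R)).

(* The integral is over the support of W, which has probability one: elsewhere
   the multipliers, hence the integrand, are unspecified. *)
Definition Psi (Pobs : probability (borel obsT) R) (tau : R) (b : 'cV[R]_k)
    (lam : multiplier) : \bar R :=
  (\int[Pobs]_(w in obs_support Pobs)
     (sup [set S_dual tau b lam w a | a in K_int Pobs b])%:E)%E.

(* Knots kap 0 < ... < kap L with end points lo and hi; thus L = 0 exactly when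
   lo = hi. *)
Definition knots (lo hi : R) (L : nat) (kap : nat -> R) : Prop :=
  [/\ kap 0%N = lo, kap L = hi & forall l, (l < L)%N -> kap l < kap l.+1].

(* The piecewise-linear function on [kap 0, kap L] equal to 1 at kap l and to 0
   at the other knots; it is the constant 1 when L = 0. *)
Definition hat (L : nat) (kap : nat -> R) (l : nat) (a : R) : R :=
  Num.max 0 (Num.min
    (if l is l'.+1 then (a - kap l') / (kap l - kap l') else 1)
    (if (l < L)%N then (kap l.+1 - a) / (kap l.+1 - kap l) else 1)).

Definition cells (Pobs : probability (borel obsT) R) (G : nat)
    (D : nat -> set regT) : Prop :=
  partition `I_G D (reg_support Pobs) /\
  forall g, (g < G)%N -> measurable (D g : set (borel regT)).

(* Multipliers are functions on (support of X) x K_b, so membership constrains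
   their values there only. *)
Definition multiplier_cone (Pobs : probability (borel obsT) R) (b : 'cV[R]_k)
    (G : nat) (D : nat -> set regT) (L : nat) (kap : nat -> R) :
    set multiplier :=
  [set lam | exists theta : 'I_T -> bool -> 'I_G -> 'I_L.+1 -> R,
    (forall t s g l, 0 <= theta t s g l) /\
    forall t s x a, reg_support Pobs x -> K_int Pobs b a ->
      lam t s x a =
        \sum_(g < G) \1_(D g) x * \sum_(l < L.+1) theta t s g l * hat L kap l a].

(* An element of C_+(X x K_b)^(2T). *)
Definition cont_multiplier (Pobs : probability (borel obsT) R) (b : 'cV[R]_k)
    (f : multiplier) : Prop :=
  forall t s,
    {within reg_support Pobs `*` K_int Pobs b,
       continuous (fun p : condT => f t s p.1 p.2)} /\
    forall x a, reg_support Pobs x -> K_int Pobs b a -> 0 <= f t s x a.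

Definition uniformly_approximable (Pobs : probability (borel obsT) R)
    (b : 'cV[R]_k) (F : set multiplier) (f : multiplier) : Prop :=
  forall eps : R, 0 < eps -> exists2 lam, F lam &
    forall t s x a, reg_support Pobs x -> K_int Pobs b a ->
      `|f t s x a - lam t s x a| <= eps.

Definition dual_set (Pobs : probability (borel obsT) R) (tau : R)
    (B : set 'cV[R]_k) (Lam : 'cV[R]_k -> set multiplier) : set 'cV[R]_k :=
  [set b | B b /\ forall lam, Lam b lam -> (0 <= Psi Pobs tau b lam)%E].

End Model.

(* Main.v *)
(* Inclusion of Theta_I in the dual sets: under an admissible law the effect A
   lies in K_b almost surely, because U_t < 0 for every t when A > max K_b, and
   U_t > 0 for every t when A < min K_b.  Hence S_b(W, A; lambda) is at most its
   maximum over K_b, and the conditional quantile restrictions make its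
   expectation nonnegative.

   Converse, without any minimax theorem: density gives Psi_b >= 0 for all
   bounded nonnegative continuous multipliers.  By Hahn-Banach there is a
   positive, merely finitely additive functional F on bounded functions of
   (w, a), w in W and a in K_b, whose w-marginal is P^obs and with
   F(S_b(.; lambda)) >= 0 for all these lambda.  For fixed c, the set function
   A |-> F(1_A(w) 1(a <= c)) is dominated by P^obs, hence countably additive with
   a density; these densities, taken at dyadic c, are distribution functions,
   and inverting them against an independent uniform variable u yields q(w, u)
   such that F(phi) = E[phi(w, q)] for continuous phi.  The law of
   (y, x, q, y_t - x_t'b - q) is then admissible: upper semicontinuous
   indicators are reached by decreasing continuous approximations, and
   continuous test functions of (x, a) suffice by regularity of Borel laws. *)
Require Import Defs.
From HB Require Import structures.
From mathcomp Require Import all_boot all_order all_algebra.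
From mathcomp Require Import all_classical all_reals all_analysis.
From mathcomp Require Import measurable_realfun ring lra.

Set Implicit Arguments.
Unset Strict Implicit.
Unset Printing Implicit Defensive.

Import Order.TTheory GRing.Theory Num.Theory.
Import numFieldNormedType.Exports.

Local Open Scope classical_set_scope.
Local Open Scope ring_scope.

(** * Hahn-Banach for a dominating sublinear functional *)

(** The dual functions jump in a, so positivity of [Psi] is not turned into a saddle point but read
    as absence of arbitrage: if buying S_b costs nothing, no function h of w with E h < 0 dominates
    S_b on the support times K_b. Only majorants h(w) occur, so neither regularity in a nor a
    measurable maximizer comes in. The obstacle is that a linear functional F below the resulting
    price is not a measure: it respects order and uniform limits, but not pointwise limits in (w,
    a). This dictates the order of the steps. Every limit under F is uniform, which is why the
    representation is stated for phi uniformly continuous in a and why compactness of the support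
    matters beyond making K_b bounded. Every pointwise limit, in particular the passage to
    indicators, is taken only after F has been replaced by the genuine law of (w, q). In the
    variable w nothing is lost, because the w-marginal is prescribed exactly. The quantile map takes
    the place of a disintegration. *)

Section HahnBanach.
Context (R : realType) (V : lmodType R) (D : set V).
Hypothesis D0 : D 0.
Hypothesis DD : forall x y, D x -> D y -> D (x + y).
Hypothesis DZ : forall a x, D x -> D (a *: x).

(** [D] is a subspace kept as a set, so that bounded functions need no type of their own.
    Homogeneity is asked as an inequality, which infima satisfy directly; applied to the inverse
    scalar it gives the equality. *)
Definition sublinear_on (p : V -> R) : Prop :=
  (forall x y, D x -> D y -> p (x + y) <= p x + p y) /\
  (forall a x, 0 <= a -> D x -> p (a *: x) <= a * p x).

Lemma sublinear_on0 p : sublinear_on p -> p 0 = 0.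
Proof.
move=> [pD pZ]; apply/eqP; rewrite eq_le; apply/andP; split.
  by have := pZ 0 0 (lexx _) D0; rewrite scale0r mul0r.
by have := pD 0 0 D0 D0; rewrite addr0 lerDl.
Qed.

Lemma sublinear_onZ p a x : sublinear_on p -> 0 <= a -> D x ->
  p (a *: x) = a * p x.
Proof.
move=> ps; rewrite le_eqVlt => /predU1P[<-|a0] Dx.
  by rewrite scale0r mul0r sublinear_on0.
apply/eqP; rewrite eq_le ps.2 ?(ltW a0)//=.
have := ps.2 a^-1 (a *: x); rewrite scalerA mulVf ?gt_eqF// scale1r.
rewrite invr_ge0 (ltW a0) => /(_ isT (DZ _ Dx)).
by rewrite ler_pdivlMl.
Qed.

Lemma domainN x : D x -> D (- x).
Proof. by move=> Dx; rewrite -scaleN1r; exact: DZ. Qed.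

Lemma sublinear_on_ge p x : sublinear_on p -> D x -> - p (- x) <= p x.
Proof.
move=> ps Dx; rewrite lerNl -subr_ge0 opprK -(sublinear_on0 ps).
by rewrite addrC -[X in p X <= _](subrr x); apply: ps.1 => //; exact: domainN.
Qed.

Lemma inf_le_of (A : set R) a m : lbound A m -> A a -> inf A <= a.
Proof. by move=> Am Aa; apply: ge_inf => //; exists m. Qed.

Variable q : V -> R.
Hypothesis q_sublinear : sublinear_on q.

Let below (p : V -> R) := sublinear_on p /\ forall x, D x -> p x <= q x.

(* A minimal sublinear minorant of [q], obtained by Zorn, is linear. *)
Lemma sublinear_minimal : exists2 p, below p &
  forall s, below s -> (forall x, D x -> s x <= p x) ->
    forall x, D x -> p x <= s x.
Proof.
pose T := {p : V -> R | below p}.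
(* The order is reversed: [le s t] says that [t] lies below [s] on [D], so a maximal element is a
   minimal functional. *)
pose le (s t : T) : bool := `[< forall x, D x -> sval t x <= sval s x >].
have bq : below q by split.
have [||A Atot|t tmax] := @ZL_preorder T (exist _ q bq) le.
- by move=> t; apply/asboolP.
- move=> r s t /asboolP rs /asboolP st; apply/asboolP => x Dx.
  exact: le_trans (st _ Dx) (rs _ Dx).
- have [->|/set0P[s0 As0]] := eqVneq A set0; first by exists (exist _ q bq).
  pose S x := [set sval s x | s in A].
  pose p x := inf (S x).
  (* A bound common to the whole chain: [- s (- x) <= s x] by sublinearity and
     [s (- x) <= q (- x)]. *)
  have Slb x : D x -> lbound (S x) (- q (- x)).
    move=> Dx _ [[s [ss sq]] /= _ <-].
    by apply: le_trans (sublinear_on_ge ss Dx); rewrite lerN2 sq//; exact: domainN.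
  have Sn0 x : S x !=set0 by exists (sval s0 x), s0.
  have ple s x : A s -> D x -> p x <= sval s x.
    by move=> As Dx; apply: (inf_le_of (Slb _ Dx)); exists s.
  have plb x m : (forall s, A s -> m <= sval s x) -> m <= p x.
    by move=> mS; apply: lb_le_inf => // _ [s As <-]; exact: mS.
  have bp : below p.
    split; last first.
      by move=> x Dx; apply: le_trans (ple _ _ As0 Dx) _; exact: (svalP s0).2.
    split=> [x y Dx Dy|a x a0 Dx].
      rewrite -lerBlDr; apply: (plb) => s As; rewrite lerBlDr -lerBlDl.
      apply: (plb) => s' As'; rewrite lerBlDl.
      (* The lower of the two comparable functionals is the one evaluated at [x + y]. *)
      have [/asboolP ss|/asboolP ss] := Atot _ _ As As'.
        apply: le_trans (ple _ _ As' (DD Dx Dy)) _.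
        by apply: le_trans ((svalP s').1.1 _ _ Dx Dy) _; rewrite lerD2r ss.
      apply: le_trans (ple _ _ As (DD Dx Dy)) _.
      by apply: le_trans ((svalP s).1.1 _ _ Dx Dy) _; rewrite lerD2l ss.
    have [->|an0] := eqVneq a 0.
      rewrite scale0r mul0r; apply: le_trans (ple _ _ As0 D0) _.
      by rewrite (sublinear_on0 (svalP s0).1).
    have a_gt0 : 0 < a by rewrite lt_neqAle eq_sym an0.
    rewrite -ler_pdivrMl//; apply: (plb) => s As; rewrite ler_pdivrMl//.
    apply: le_trans (ple _ _ As (DZ _ Dx)) _.
    by rewrite (sublinear_onZ (svalP s).1).
  by exists (exist _ p bp) => s As; apply/asboolP => x Dx /=; exact: ple.
exists (sval t); first exact: (svalP t).
move=> s bs st; have /asboolP := tmax (exist _ s bs) (asboolT st).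
by [].
Qed.

(** For additivity, [p] is compared with the infimum over [a >= 0] of [p (x + a *: y) - a * p y].
    Minimality puts [p x] below every term, and the term at [a = 1] gives [p x + p y <= p (x + y)].
    Additivity makes [p] odd, which extends homogeneity to negative scalars. *)
Lemma dominated_linear : exists2 F : V -> R, forall x, D x -> F x <= q x &
  (forall x y, D x -> D y -> F (x + y) = F x + F y) /\
  (forall a x, D x -> F (a *: x) = a * F x).
Proof.
have [p [ps pq] pmin] := sublinear_minimal.
have padd x y : D x -> D y -> p (x + y) = p x + p y.
  move=> Dx Dy; apply/eqP; rewrite eq_le ps.1//=.
  (* [s] is sublinear and below [p], so minimality forces [s = p]. *)
  pose S x := [set p (x + a *: y) - a * p y | a in [set a : R | 0 <= a]].
  pose s x := inf (S x).
  have Slb z : D z -> lbound (S z) (- p (- z)).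
    move=> Dz _ [a /= a0 <-]; rewrite lerBrDr addrC lerBlDr.
    rewrite -(sublinear_onZ ps)//.
    apply: le_trans (ps.1 _ _ (DD Dz (DZ a Dy)) (domainN Dz)).
    by rewrite addrAC subrr add0r.
  have sle z a : D z -> 0 <= a -> s z <= p (z + a *: y) - a * p y.
    by move=> Dz a0; apply: (inf_le_of (Slb _ Dz)); exists a.
  have slb z m : (forall a, 0 <= a -> m <= p (z + a *: y) - a * p y) -> m <= s z.
    move=> mS; apply: lb_le_inf => [|_ [a /= a0 <-]]; last exact: mS.
    by exists (p (z + 0 *: y) - 0 * p y), 0 => /=.
  have sp z : D z -> s z <= p z.
    by move=> Dz; have := sle _ 0 Dz (lexx _); rewrite scale0r mul0r subr0 addr0.
  have ss : below s.
    split; last by move=> z Dz; apply: le_trans (sp _ Dz) (pq _ Dz).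
    split=> [u v Du Dv|a u a0 Du].
      rewrite -lerBlDr; apply: (slb) => a a0; rewrite lerBlDr -lerBlDl.
      apply: (slb) => a' a'0; rewrite lerBlDl.
      apply: le_trans (sle _ (a + a') (DD Du Dv) (addr_ge0 a0 a'0)) _.
      rewrite addrACA -opprD -mulrDl lerB// scalerDl addrACA.
      by apply: ps.1; apply: DD => //; exact: DZ.
    have [->|an0] := eqVneq a 0.
      by rewrite scale0r mul0r -(sublinear_on0 ps); exact: sp.
    have a_gt0 : 0 < a by rewrite lt_neqAle eq_sym an0.
    rewrite -ler_pdivrMl//; apply: (slb) => c c0; rewrite ler_pdivrMl//.
    apply: le_trans (sle _ (a * c) (DZ _ Du) (mulr_ge0 a0 c0)) _.
    by rewrite mulrBr mulrA lerB// -scalerA -scalerDr (sublinear_onZ ps)//;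
      apply: DD => //; exact: DZ.
  have := le_trans (pmin _ ss sp x Dx) (sle x 1 Dx ler01).
  by rewrite scale1r mul1r lerBrDr.
have pN x : D x -> p (- x) = - p x.
  move=> Dx; apply/eqP; rewrite -addr_eq0 -padd ?addNr ?(sublinear_on0 ps)//.
  exact: domainN.
exists p => //; split=> // a x Dx.
have [a0|a0] := leP 0 a; first exact: sublinear_onZ.
by rewrite -[a]opprK scaleNr pN ?(sublinear_onZ ps)// ?mulNr ?oppr_ge0 ?ltW//;
  exact: DZ.
Qed.

End HahnBanach.

(** * Bounded measurable functions *)

Section BoundedMeasurable.
Context d (Om : measurableType d) (R : realType) (P : probability Om R).

Definition bounded_measurable (h : Om -> R) : Prop :=
  measurable_fun setT h /\ exists M, forall w, `|h w| <= M.

Lemma bounded_measurable_cst c : bounded_measurable (fun=> c).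
Proof. by split; [exact: measurable_cst | exists `|c|]. Qed.

Lemma bounded_measurableD h1 h2 : bounded_measurable h1 ->
  bounded_measurable h2 -> bounded_measurable (fun w => h1 w + h2 w).
Proof.
move=> [mh1 [M1 h1M]] [mh2 [M2 h2M]]; split; first exact: measurable_funD.
by exists (M1 + M2) => w; apply: le_trans (ler_normD _ _) (lerD _ _).
Qed.

Lemma bounded_measurableM h1 h2 : bounded_measurable h1 ->
  bounded_measurable h2 -> bounded_measurable (fun w => h1 w * h2 w).
Proof.
move=> [mh1 [M1 h1M]] [mh2 [M2 h2M]]; split; first exact: measurable_funM.
by exists (M1 * M2) => w; rewrite normrM ler_pM.
Qed.

Lemma bounded_measurableZ c h : bounded_measurable h ->
  bounded_measurable (fun w => c * h w).
Proof. exact/bounded_measurableM/bounded_measurable_cst. Qed.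

Lemma bounded_measurableN h : bounded_measurable h ->
  bounded_measurable (fun w => - h w).
Proof.
by move=> /(bounded_measurableZ (-1)); under eq_fun do rewrite mulN1r.
Qed.

Lemma bounded_measurableB h1 h2 : bounded_measurable h1 ->
  bounded_measurable h2 -> bounded_measurable (fun w => h1 w - h2 w).
Proof. by move=> bh1 /bounded_measurableN; exact: bounded_measurableD. Qed.

Lemma bounded_measurable_indic A : measurable A -> bounded_measurable \1_A.
Proof.
move=> mA; split; first exact: measurable_indic.
by exists 1 => w; rewrite indicE; case: (_ \in _); rewrite ?normr1 ?normr0.
Qed.

Lemma bounded_measurable_sum n (h : 'I_n -> Om -> R) :
  (forall i, bounded_measurable (h i)) ->
  bounded_measurable (fun w => \sum_(i < n) h i w).
Proof.
elim: n h => [h _|n IH h bh].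
  by under eq_fun do rewrite big_ord0; exact: bounded_measurable_cst.
under eq_fun do rewrite big_ord_recr/=.
by apply: bounded_measurableD => //; exact: IH.
Qed.

Lemma bounded_measurable_integrable h : bounded_measurable h ->
  P.-integrable setT (EFin \o h).
Proof.
move=> [mh [M hM]]; apply: measurable_bounded_integrable => //.
  by rewrite ltey_eq fin_num_measure.
exists M; split; first exact: num_real.
by move=> x Mx w _ /=; exact: le_trans (hM w) (ltW Mx).
Qed.

Local Notation E h := (\int[P]_w h w).

Lemma EFin_Rintegral h : bounded_measurable h ->
  (E h)%:E = (\int[P]_w (h w)%:E)%E.
Proof.
move=> /bounded_measurable_integrable ih.
by rewrite /Rintegral fineK//; exact: integrable_fin_num.
Qed.

Lemma Rintegral_bmD h1 h2 : bounded_measurable h1 -> bounded_measurable h2 ->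
  \int[P]_w (h1 w + h2 w) = E h1 + E h2.
Proof. by move=> b1 b2; apply: RintegralD => //; exact: bounded_measurable_integrable. Qed.

Lemma Rintegral_bmB h1 h2 : bounded_measurable h1 -> bounded_measurable h2 ->
  \int[P]_w (h1 w - h2 w) = E h1 - E h2.
Proof. by move=> b1 b2; apply: RintegralB => //; exact: bounded_measurable_integrable. Qed.

Lemma Rintegral_bmZ c h : bounded_measurable h ->
  \int[P]_w (c * h w) = c * E h.
Proof. by move=> b; apply: RintegralZl => //; exact: bounded_measurable_integrable. Qed.

Lemma Rintegral_bmN h : bounded_measurable h ->
  \int[P]_w (- h w) = - E h.
Proof.
move=> b; rewrite -mulN1r -Rintegral_bmZ//.
by apply: eq_Rintegral => w _; rewrite mulN1r.
Qed.

Lemma Rintegral_prob_cst c : \int[P]_w c = c.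
Proof.
rewrite Rintegral_cst//.
rewrite [fine _](_ : _ = fine 1%E) ?mulr1//.
congr fine; exact: probability_setT.
Qed.

Lemma Rintegral_bm_sum n (h : 'I_n -> Om -> R) :
  (forall i, bounded_measurable (h i)) ->
  \int[P]_w (\sum_(i < n) h i w) = \sum_(i < n) E (h i).
Proof.
elim: n h => [h _|n IH h bh].
  rewrite big_ord0 -[RHS]Rintegral_prob_cst.
  by apply: eq_Rintegral => w _; rewrite big_ord0.
rewrite big_ord_recr/= -IH// -Rintegral_bmD//.
  by apply: eq_Rintegral => w _; rewrite big_ord_recr.
exact: bounded_measurable_sum.
Qed.

Lemma le_Rintegral_bm h1 h2 : bounded_measurable h1 -> bounded_measurable h2 ->
  (forall w, h1 w <= h2 w) -> E h1 <= E h2.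
Proof.
by move=> b1 b2 le12; apply: le_Rintegral => //; exact: bounded_measurable_integrable.
Qed.

Lemma Rintegral_bm_indic A : measurable A -> (E \1_A)%:E = P A.
Proof.
move=> mA; rewrite EFin_Rintegral; last exact: bounded_measurable_indic.
by rewrite integral_indic// setIT.
Qed.

End BoundedMeasurable.

(** * Finitely additive functionals with a given marginal *)

Section MarginalFunctional.
Context d (Om : measurableType d) (R : realType) (P : probability Om R).
Context (Y : Type) (Z : set (Om * Y)).

(** Boundedness is the only requirement: functions of (w, a) carry no measurability until the
    functional has been represented by a law. *)
Definition bounded_on (f : Om * Y -> R) : Prop :=
  exists M, forall z, Z z -> `|f z| <= M.

Lemma bounded_on_add f g : bounded_on f -> bounded_on g -> bounded_on (f + g).
Proof.
move=> [M fM] [N gN]; exists (M + N) => z Zz.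
by apply: le_trans (ler_normD _ _) _; rewrite lerD ?fM ?gN.
Qed.

Lemma bounded_on_scale a f : bounded_on f -> bounded_on (a *: f).
Proof.
move=> [M fM]; exists (`|a| * M) => z Zz.
by rewrite normrM ler_wpM2l ?fM.
Qed.

Variable C : set (Om * Y -> R).
Hypothesis C0 : C 0.
Hypothesis CD : forall s t, C s -> C t -> C (s + t).
Hypothesis CZ : forall a s, 0 <= a -> C s -> C (a *: s).
Hypothesis C_bounded : C `<=` bounded_on.
Hypothesis C_ge0 : forall s h, C s -> bounded_measurable h ->
  (forall z, Z z -> s z <= h z.1) -> 0 <= \int[P]_w h w.

(* [inf (Q f)] is the superhedging price of [f] when the elements of [C] cost
   nothing; a linear functional below it has marginal [P] and is nonnegative on
   [C]. *)
Let Q f := [set r | exists h s, [/\ bounded_measurable h, C s,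
  (forall z, Z z -> f z + s z <= h z.1) & r = \int[P]_w h w]].

(** Each property of [F] is one explicit hedge. A function that is nonpositive on [Z] costs at most
    0, which gives monotonicity. A function [h] of w costs at most its integral, and so does its
    opposite, which fixes the marginal. Finally [- s] is hedged at no cost by [s] itself, so
    [F s >= 0]. *)
Lemma marginal_functional : exists F : (Om * Y -> R) -> R,
  [/\ forall f g, bounded_on f -> bounded_on g -> F (f + g) = F f + F g,
      forall a f, bounded_on f -> F (a *: f) = a * F f,
      forall f g, bounded_on f -> bounded_on g ->
        (forall z, Z z -> f z <= g z) -> F f <= F g,
      forall h, bounded_measurable h -> F (h \o fst) = \int[P]_w h w &
      forall s, C s -> 0 <= F s].
Proof.
(* The no-arbitrage hypothesis [C_ge0] enters here: [f + s <= h] and [f >= - M] give [s <= h + M],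
   hence [E h >= - M], and prices are finite. *)
have Qlb f M : (forall z, Z z -> `|f z| <= M) -> lbound (Q f) (- M).
  move=> fM _ [h [s [bh Cs fsh ->]]]; rewrite -subr_ge0 opprK.
  rewrite -[X in _ + X](Rintegral_prob_cst P) -Rintegral_bmD//; last first.
    exact: bounded_measurable_cst.
  apply: (C_ge0 Cs); first exact/bounded_measurableD/bounded_measurable_cst.
  move=> z Zz; rewrite -lerBlDr; apply: le_trans (fsh z Zz).
  by rewrite addrC lerD2r; apply: lerNnormlW; exact: fM.
have Qub f M : (forall z, Z z -> `|f z| <= M) -> Q f M.
  move=> fM; exists (fun=> M), 0; split => //.
  - exact: bounded_measurable_cst.
  - by move=> z Zz; rewrite addr0 (le_trans (ler_norm _))// fM.
  - by rewrite Rintegral_prob_cst.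
pose q f := inf (Q f).
have qle f r : bounded_on f -> Q f r -> q f <= r.
  by move=> [M fM]; apply: inf_le_of; exact: Qlb fM.
have qge f m : bounded_on f -> (forall r, Q f r -> m <= r) -> m <= q f.
  by move=> [M fM] mQ; apply: lb_le_inf => //; exists M; exact: Qub fM.
have b0 : bounded_on 0 by exists 0 => z _; rewrite normr0.
have qs : sublinear_on bounded_on q.
  split=> [f g bf bg|a f a0 bf].
    rewrite -lerBlDr; apply: (qge) => // r [h [s [bh Cs fsh ->]]].
    rewrite lerBlDr -lerBlDl; apply: (qge) => // r' [h' [s' [bh' Cs' gsh ->]]].
    rewrite lerBlDl -Rintegral_bmD//; apply: qle; first exact: bounded_on_add.
    exists (fun w => h w + h' w), (s + s'); split => //.
    - exact: bounded_measurableD.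
    - exact: CD.
    - by move=> z Zz; rewrite addrACA lerD ?fsh ?gsh.
  have [->|an0] := eqVneq a 0.
    rewrite scale0r mul0r; apply: qle => //.
    by apply: (Qub _ 0) => z _; rewrite normr0.
  have a_gt0 : 0 < a by rewrite lt_neqAle eq_sym an0.
  rewrite -ler_pdivrMl//; apply: (qge) => // r [h [s [bh Cs fsh ->]]].
  rewrite ler_pdivrMl// -Rintegral_bmZ//; apply: qle.
    exact: bounded_on_scale.
  exists (fun w => a * h w), (a *: s); split => //.
  - exact: bounded_measurableZ.
  - exact: CZ.
  - by move=> z Zz; rewrite -mulrDr ler_wpM2l// fsh.
have [F Fq [FD FZ]] := dominated_linear b0 bounded_on_add bounded_on_scale qs.
have bN f : bounded_on f -> bounded_on (- f).
  by move=> bf; rewrite -scaleN1r; exact: bounded_on_scale.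
have FN f : bounded_on f -> F (- f) = - F f.
  by move=> bf; rewrite -scaleN1r FZ// mulN1r.
have F_le0 f : bounded_on f -> (forall z, Z z -> f z <= 0) -> F f <= 0.
  move=> bf f0; apply: le_trans (Fq _ bf) _; apply: qle => //.
  exists (fun=> 0), 0; split => //; first exact: bounded_measurable_cst.
    by move=> z Zz; rewrite addr0 f0.
  by rewrite Rintegral_prob_cst.
have F_le h : bounded_measurable h -> F (h \o fst) <= \int[P]_w h w.
  move=> bh; have [_ [M hM]] := bh.
  have bh1 : bounded_on (h \o fst) by exists M => z _; exact: hM.
  apply: le_trans (Fq _ bh1) _; apply: qle => //.
  by exists h, 0; split => // z Zz; rewrite addr0.
exists F; split => //.
- move=> f g bf bg fg; rewrite -subr_le0 -FN// -FD//; last exact: bN.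
  apply: F_le0 => [|z Zz]; first by apply: bounded_on_add => //; exact: bN.
  by rewrite subr_le0 fg.
- move=> h bh; apply/eqP; rewrite eq_le F_le//=.
  have [_ [M hM]] := bh.
  have bh1 : bounded_on (h \o fst) by exists M => z _; exact: hM.
  have := F_le _ (bounded_measurableN bh).
  rewrite Rintegral_bmN//.
  rewrite -[X in F X]/(- (h \o fst)) FN// lerN2.
  by [].
- move=> s Cs; rewrite -oppr_le0 -FN; last exact: C_bounded.
  have bs := bN _ (C_bounded Cs).
  apply: le_trans (Fq _ bs) _; apply: qle => //.
  exists (fun=> 0), s; split => //; first exact: bounded_measurable_cst.
    by move=> z Zz; rewrite addrC subrr.
  by rewrite Rintegral_prob_cst.
Qed.

End MarginalFunctional.

(** * Densities of finitely additive set functions dominated by a probability *)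

Section DominatedDensity.
Context d (Om : measurableType d) (R : realType) (P : probability Om R).
Context (v : set Om -> R).
Hypothesis v_ge0 : forall A, 0 <= v A.
Hypothesis v_add : forall A B, measurable A -> measurable B ->
  A `&` B = set0 -> v (A `|` B) = v A + v B.
Hypothesis v_le : forall A, measurable A -> ((v A)%:E <= P A)%E.

Let nu A := (v A)%:E.

Let v0 : v set0 = 0.
Proof.
have /(congr1 (fun x => x - v set0)) :=
  v_add measurable0 measurable0 (setI0 (@set0 Om)).
by rewrite setU0 subrr addrK => <-.
Qed.

Let nu0 : nu set0 = 0%E. Proof. by rewrite /nu v0. Qed.

Let nu_ge0 A : (0 <= nu A)%E. Proof. by rewrite lee_fin. Qed.

(* Finite additivity together with domination by a countably additive measure
   forces countable additivity: the tails are squeezed to 0. *)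
Let nu_sigma_additive : semi_sigma_additive nu.
Proof.
move=> F mF tF mUF; set U := \bigcup_n F n.
pose G n := \big[setU/set0]_(i < n) F i.
have mG n : measurable (G n) by exact: bigsetU_measurable.
have GU n : G n `<=` U.
  by rewrite /G -bigcup_mkord => x [i _ Fix]; exists i.
have sumv n : (\sum_(0 <= i < n) nu (F i) = nu (G n))%E.
  elim: n => [|n IH]; first by rewrite big_nil /G big_ord0 nu0.
  rewrite big_nat_recr//= IH /G big_ord_recr/= /nu v_add//; first exact: mG.
  rewrite -bigcup_mkord; apply/eqP/negPn/negP => /set0P[x [[i /= ni Fi] Fn]].
  by have := tF i n I I (ex_intro _ x (conj Fi Fn)); move: ni => /[swap] ->; rewrite ltnn.
under eq_fun do rewrite sumv.
have sumP : (fun n => P (G n)) @ \oo --> P U.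
  have sP n : (\sum_(0 <= i < n) P (F i) = P (G n))%E.
    by rewrite big_mkord /G measure_semi_additive//; exact: mG.
  have := @measure_semi_sigma_additive _ _ _ P _ mF tF mUF.
  by under eq_fun do rewrite sP.
have PUfin : P U \is a fin_num by exact: fin_num_measure.
apply: (@squeeze_cvge _ _ _ _ (fun n => nu U - P U + P (G n))%E _ (fun=> nu U)).
- apply: nearW => n.
  have mUG : measurable (U `\` G n) by exact: measurableD.
  have UE : U = G n `|` (U `\` G n) by rewrite setDUK.
  have dis : G n `&` (U `\` G n) = set0 by rewrite setDIK.
  have vU : v U = v (G n) + v (U `\` G n) by rewrite {1}UE v_add.
  have PU : P U = (P (G n) + P (U `\` G n))%E by rewrite {1}UE measureU.
  have := v_le mUG.
  rewrite /nu vU lee_fin lerDl v_ge0 andbT PU.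
  have : P (G n) \is a fin_num by exact: fin_num_measure.
  have : P (U `\` G n) \is a fin_num by exact: fin_num_measure.
  case: (P (G n)) => // r; case: (P (_ `\` _)) => // s _ _.
  rewrite -!EFinD !lee_fin => vs.
  by rewrite opprD addrA addrAC subrK lerBlDr lerD2l.
- rewrite -[X in _ --> X](@subeK _ _ (P U))//.
  apply: cvgeD => //; last exact: cvg_cst.
  by apply: fin_num_adde_defl.
- exact: cvg_cst.
Qed.

HB.instance Definition _ := isMeasure.Build _ _ _ nu nu0 nu_ge0 nu_sigma_additive.

Let nu_fin : fin_num_fun nu. Proof. by []. Qed.

HB.instance Definition _ := Measure_isFinite.Build _ _ _ nu nu_fin.

(** Domination makes the Radon-Nikodym density at most 1 almost everywhere; truncating it at 1 gives
    the bounds at every point, as distribution functions will require. *)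
Lemma dominated_density : exists g : Om -> R,
  [/\ measurable_fun setT g, forall w, 0 <= g w <= 1 &
   forall A, measurable A -> v A = \int[P]_w (g w * \1_A w)].
Proof.
have nuP : nu `<< P.
  apply/null_content_dominatesP => A mA PA0; apply/eqP.
  by rewrite eq_le nu_ge0 -PA0 andbT v_le.
have [f [f0 ffin fint fE]] := @radon_nikodym_sigma_finite _ _ _ P nu nuP.
have mf : measurable_fun setT f := measurable_int _ fint.
(* On a subset of [f > 1] the integral of [f] is at least that of 1, and by domination at most that.
   Hence [f] is 1 almost everywhere on that set, which is impossible unless the set is null. *)
have f1 : \forall x \ae P, (f x <= 1)%E.
  set D := [set x | (1 < f x)%E].
  have mD : measurable D.
    by have := emeasurable_fun_o_infty measurableT mf 1; rewrite setTI.
  have : ae_eq P D f (cst 1%E).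
    apply: (integral_ae_eq mD).
    - exact: integrableS fint.
    - exact: measurable_cst.
    - move=> E ED mE; apply/eqP; rewrite eq_le; apply/andP; split.
        by rewrite -fE// integral_cst// mul1e; exact: v_le.
      apply: ge0_le_integral => //; first exact: measurable_funTS.
      by move=> x /ED /ltW.
  apply: filterS => x fx; rewrite leNgt; apply/negP => Dx.
  by move: (Dx); rewrite fx// ltxx.
pose g w := Num.min (fine (f w)) 1.
have mg : measurable_fun setT g.
  by apply: measurable_minr => //; exact: measurableT_comp.
have g01 w : 0 <= g w <= 1.
  by rewrite /g ge_min lexx orbT le_min ler01 fine_ge0.
exists g; split => // A mA.
have bg : bounded_measurable g.
  by split=> //; exists 1 => w; case/andP: (g01 w) => g0 g1; rewrite ger0_norm.
apply/EFin_inj; rewrite EFin_Rintegral; last first.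
  exact/bounded_measurableM/bounded_measurable_indic.
rewrite -[LHS]/(nu A) fE// [LHS]integral_mkcond.
apply: ae_eq_integral => //.
- by apply/(measurable_restrictT _ mA); exact: measurable_funTS.
- apply/measurable_EFinP; apply: measurable_funM => //; exact: measurable_indic.
- apply: filterS f1 => w fw _; rewrite patchE indicE.
  case: ifPn => _; last by rewrite mulr0.
  rewrite mulr1 /g; move: (ffin w) fw; case: (f w) => // r _.
  by rewrite lee_fin /= => r1; rewrite min_l.
Qed.

End DominatedDensity.

(** * Rounding to a grid expressed by counting *)

Section Counting.
Context (R : realType).

(* [\sum_(j < n) ~~ p j] is the least [j < n] with [p j] (or [n]) when [p] is
   monotone; this is Abel summation. *)
Lemma telescope_count (p : pred nat) (x : nat -> R) n :
  (forall j, p j -> p j.+1) ->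
  x (\sum_(j < n) ~~ p j)%N =
  x n - \sum_(j < n) (x j.+1 - x j) * (p j)%:R.
Proof.
move=> pS; elim: n => [|n IH]; first by rewrite !big_ord0 subr0.
rewrite !big_ord_recr/=; case: (boolP (p n)) => pn /=.
  by rewrite addn0 IH mulr1 addrC opprD opprB addrA subrKC.
have pF j : (j <= n)%N -> p j = false.
  move=> jn; apply: contraNF pn => pj.
  rewrite -(subnKC jn); elim: (n - j)%N => [|m IHm]; first by rewrite addn0.
  by rewrite addnS pS.
rewrite mulr0 addr0 (eq_bigr (fun=> 1%N)); last first.
  by move=> i _; rewrite (pF _ (ltnW (ltn_ord i))).
rewrite big_const_ord iter_addn_0 mul1n addn1 big1 ?subr0// => i _.
by rewrite (pF _ (ltnW (ltn_ord i)))/= mulr0.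
Qed.

Lemma sum_nat_double (a : nat -> nat) n :
  (\sum_(j < n.*2) a j = \sum_(j < n) (a j.*2 + a j.*2.+1))%N.
Proof.
elim: n => [|n IH]; first by rewrite !big_ord0.
by rewrite doubleS !big_ord_recr/= IH addnA.
Qed.

(** The count is the integer part of [t], written as a sum of indicators so that it becomes a simple
    function when [t] depends on a point. *)
Lemma floor_count (t : R) n : 0 <= t -> t < n%:R + 1 ->
  \sum_(i < n) (i.+1%:R <= t)%R%:R <= t < \sum_(i < n) (i.+1%:R <= t)%R%:R + 1.
Proof.
move=> t0; elim: n => [|n IH] tn.
  by rewrite !big_ord0 t0 add0r (lt_le_trans tn)// add0r.
rewrite !big_ord_recr/=.
have [nt|tn'] := leP n.+1%:R t; last first.
  by rewrite addr0 IH// natr1.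
rewrite (eq_bigr (fun=> 1)); last first.
  move=> i _; rewrite (le_trans _ nt)// ler_nat ltnS; exact: ltnW.
by rewrite sumr_const card_ord natr1 nt.
Qed.

(** The number of grid points strictly below [a] is the index of the first grid point that is at
    least [a], so [a] is rounded up by at most one mesh. *)
Lemma grid_count (lo d a : R) n : 0 <= d -> lo <= a -> a <= lo + d * n%:R ->
  a <= lo + d * (\sum_(j < n) (lo + d * j%:R < a)%R)%N%:R <= a + d.
Proof.
move=> d0 la; elim: n => [|n IH] an.
  by rewrite big_ord0 an mulr0 addr0 (le_trans la)// lerDl.
rewrite big_ord_recr/=; have [an'|na] := leP a (lo + d * n%:R).
  by rewrite addn0 IH.
rewrite (eq_bigr (fun=> 1%N)); last first.
  move=> i _; rewrite (le_lt_trans _ na)// lerD2l ler_wpM2l// ler_nat.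
  exact: ltnW.
rewrite big_const_ord iter_addn_0 mul1n addn1 an -natr1 mulrDr mulr1 addrA lerD2r.
exact: ltW.
Qed.

End Counting.

(** * Positive linear functionals determined by indicators *)

Section BoundedMeasurableExt.
Context d (Om : measurableType d) (R : realType).

(** [k - m] is rounded down to a multiple of [eps]; the sets are the superlevel sets of
    [(k - m) / eps] at the positive integers. All indicators get the same coefficient [eps], a sign
    that later positivity arguments use. *)
Lemma measurable_simple_approx (k : Om -> R) m M eps : measurable_fun setT k ->
  (forall w, m <= k w <= M) -> 0 < eps -> exists n (A : nat -> set Om),
    (forall i, measurable (A i)) /\
    forall w, `|k w - (m + eps * \sum_(i < n) \1_(A i) w)| <= eps.
Proof.
move=> mk kM e0.
pose n := Num.bound `|(M - m) / eps|.
have nM : (M - m) / eps < n%:R.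
  exact: le_lt_trans (ler_norm _) (archi_boundP (normr_ge0 _)).
exists n, (fun i => [set w | i.+1%:R <= (k w - m) / eps]); split.
  move=> i; rewrite -[X in measurable X]setTI.
  have mkM : measurable_fun setT (fun w => (k w - m) / eps).
    apply: measurable_funM; last exact: measurable_cst.
    by apply: measurable_funB => //; exact: measurable_cst.
  have -> : [set w | i.+1%:R <= (k w - m) / eps] =
      (fun w => (k w - m) / eps) @^-1` `[i.+1%:R, +oo[.
    by apply/seteqP; split => w /=; rewrite in_itv/= andbT.
  exact: mkM.
move=> w; set t := (k w - m) / eps.
have /andP[kl kr] := kM w.
have t0 : 0 <= t by apply: divr_ge0; [rewrite subr_ge0 | exact: ltW].
have tn : t < n%:R + 1.
  apply: le_lt_trans (_ : (M - m) / eps < _); last by rewrite (lt_le_trans nM)// lerDl.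
  by rewrite ler_wpM2r ?invr_ge0 ?(ltW e0)// lerD2r.
have := floor_count t0 tn.
rewrite (eq_bigr (fun i : 'I_n => \1_[set w | i.+1%:R <= (k w - m) / eps] w)); last first.
  by move=> i _; rewrite indicE mem_setE.
set s := \sum_(i < n) _ => /andP[st ts].
have -> : k w - (m + eps * s) = eps * (t - s).
  rewrite mulrBr /t mulrCA divff ?gt_eqF// mulr1; ring.
rewrite normrM gtr0_norm// ger0_norm ?subr_ge0// ger_pMr// lerBlDl.
exact: ltW.
Qed.

(** Positivity bounds the change of [J] under a uniform perturbation [eps] by [eps * J 1], so
    uniform approximation by simple functions suffices. As no monotone convergence is used, this
    applies to merely finitely additive functionals as well as to integrals. *)
Lemma bounded_measurable_functional_ext (J1 J2 : (Om -> R) -> R) :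
  (forall J, J = J1 \/ J = J2 -> [/\
    forall h1 h2, bounded_measurable h1 -> bounded_measurable h2 ->
      J (fun w => h1 w + h2 w) = J h1 + J h2,
    forall c h, bounded_measurable h -> J (fun w => c * h w) = c * J h &
    forall h1 h2, bounded_measurable h1 -> bounded_measurable h2 ->
      (forall w, h1 w <= h2 w) -> J h1 <= J h2]) ->
  (forall A, measurable A -> J1 \1_A = J2 \1_A) ->
  forall h, bounded_measurable h -> J1 h = J2 h.
Proof.
move=> J12 JA h bh; apply/eqP; rewrite -subr_eq0 -normr_le0.
have bone : bounded_measurable (\1_setT : Om -> R).
  exact: bounded_measurable_indic.
have bsum n (A : nat -> set Om) : (forall i, measurable (A i)) ->
    bounded_measurable (fun w => \sum_(i < n) \1_(A i) w : R).
  move=> mA; apply: bounded_measurable_sum => i.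
  exact: bounded_measurable_indic.
have Jsum J n (A : nat -> set Om) : (forall i, measurable (A i)) ->
    J = J1 \/ J = J2 ->
    J (fun w => \sum_(i < n) \1_(A i) w) = \sum_(i < n) J \1_(A i).
  move=> mA /J12[JD JZ _]; elim: n => [|n IH].
    rewrite big_ord0; under eq_fun do rewrite big_ord0.
    rewrite -[RHS](mul0r (J \1_setT)) -JZ//; congr J.
    by apply/funext => w; rewrite mul0r.
  rewrite big_ord_recr/= -IH -JD.
  - by congr J; apply/funext => w; rewrite big_ord_recr.
  - exact: bsum.
  - exact: bounded_measurable_indic.
have Jp J : J = J1 \/ J = J2 -> 0 <= J \1_setT.
  move=> /J12[JD JZ JM]; rewrite -(mul0r (J \1_setT)) -JZ//.
  apply: JM => [||w]; [exact: bounded_measurableZ|exact: bone|].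
  by rewrite mul0r indicT ler01.
have J1p := Jp _ (or_introl erefl); have J2p := Jp _ (or_intror erefl).
suff Jle eps : 0 < eps -> `|J1 h - J2 h| <= eps * (J1 \1_setT + J2 \1_setT).
  apply/ler_addgt0Pl => eps e0; rewrite addr0.
  set C := J1 _ + J2 _ in Jle.
  (* The added 1 keeps the denominator positive when both functionals vanish on the constant 1. *)
  have C1 : 0 < C + 1 by rewrite ltr_wpDl// addr_ge0.
  apply: le_trans (Jle (eps / (C + 1)) _) _; first exact: divr_gt0.
  by rewrite mulrAC ler_pdivrMr// ler_pM2l// lerDl.
move=> e0; have [mh [M hM]] := bh.
have [|n [A [mA hA]]] := measurable_simple_approx (m := - M) (M := M) mh _ e0.
  by move=> w; rewrite -ler_norml.
set c := - M in hA; set e := eps in hA.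
pose s w : R := c * \1_setT w + e * \sum_(i < n) \1_(A i) w.
have bs : bounded_measurable s.
  by apply: bounded_measurableD; apply: bounded_measurableZ => //; exact: bsum.
have Js : J1 s = J2 s.
  have J12s J : J = J1 \/ J = J2 ->
      J s = c * J \1_setT + e * \sum_(i < n) J \1_(A i).
    move=> Ji; have [JD JZ JM] := J12 _ Ji.
    by rewrite /s JD ?JZ ?Jsum//; do ?[exact: bsum | apply: bounded_measurableZ].
  rewrite (J12s _ (or_introl erefl)) (J12s _ (or_intror erefl)) JA//.
  by congr (_ + _ * _); apply: eq_bigr => i _; rewrite JA.
have Jdist J : J = J1 \/ J = J2 -> `|J h - J s| <= eps * J \1_setT.
  move=> Ji; have [JD JZ JM] := J12 _ Ji.
  have sE w : s w = c + e * \sum_(i < n) \1_(A i) w by rewrite /s indicT mulr1.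
  have be := bounded_measurableZ eps bone.
  rewrite ler_distl; apply/andP; split.
    rewrite lerBlDr -JZ// -JD//; apply: JM => //; first exact: bounded_measurableD.
    move=> w; have := hA w; rewrite -sE ler_distl => /andP[+ _].
    by rewrite indicT mulr1 lerBlDr.
  rewrite -JZ// -JD//; apply: JM => //; first exact: bounded_measurableD.
  move=> w; have := hA w; rewrite -sE ler_distl => /andP[_].
  by rewrite indicT mulr1.
rewrite mulrDr (le_trans (ler_distD (J1 s) _ _))// lerD ?Jdist//; first by left.
by rewrite Js distrC Jdist//; right.
Qed.

End BoundedMeasurableExt.

(** * Adjoining an independent uniform variable *)

Section UniformExtension.
Context d (Om : measurableType d) (R : realType) (P : probability Om R).

Let unif : probability (measurableTypeR R) R := uniform_prob (@ltr01 R).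

Definition uniform_extension : probability (Om * measurableTypeR R)%type R :=
  (P \x unif)%E.

Lemma uniform_prob_le (h : R) : 0 <= h <= 1 ->
  unif [set u | u <= h] = h%:E.
Proof.
move=> /andP[h0 h1]; rewrite /unif/= /uniform_prob integral_uniform_pdf.
have -> : [set u | u <= h] `&` `[0, 1]%classic = `[0, h]%classic.
  apply/seteqP; split=> u /=; rewrite !in_itv/=; first by move=> [-> /andP[->]].
  by move=> /andP[-> uh]; rewrite uh (le_trans uh).
under eq_integral => u.
  rewrite inE/= in_itv/= => /andP[u0 uh].
  rewrite /uniform_pdf u0 (le_trans uh)//= subr0 invr1.
  over.
rewrite integral_cst//= lebesgue_measure_itv/= lte_fin mul1e sube0.
by case: ltgtP h0 => // <-.
Qed.

Lemma bounded_measurable_fst (k : Om -> R) : bounded_measurable k ->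
  bounded_measurable (fun z : Om * measurableTypeR R => k z.1).
Proof.
move=> [mk [M kM]]; split; last by exists M => z; exact: kM.
exact: measurableT_comp.
Qed.

Lemma measurable_subgraph (h : Om -> R) : measurable_fun setT h ->
  measurable [set z : Om * measurableTypeR R | z.2 <= h z.1].
Proof.
move=> mh; rewrite -[X in measurable X]setTI.
have -> : [set z : Om * measurableTypeR R | z.2 <= h z.1] =
    (fun z : Om * measurableTypeR R => z.2 <= h z.1) @^-1` [set true].
  by apply/seteqP; split.
apply: (measurable_fun_ler (f := fun z : Om * measurableTypeR R => z.2)
   (g := fun z => h z.1)) => //; exact: measurableT_comp.
Qed.

Lemma bounded_measurable_subgraph (h : Om -> R) : measurable_fun setT h ->
  bounded_measurable
    (fun z : Om * measurableTypeR R => (z.2 <= h z.1)%R%:R : R).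
Proof.
move=> /measurable_subgraph/(bounded_measurable_indic R).
by congr bounded_measurable; apply/funext => z; rewrite indicE mem_setE.
Qed.

(** Integrating out u turns the event [u <= h w] into the weight [h w]. This is how a density
    produced by the functional is recognized in the law of the quantile map. *)
Lemma integral_subgraph (h k : Om -> R) : measurable_fun setT h ->
  (forall w, 0 <= h w <= 1) -> bounded_measurable k ->
  \int[uniform_extension]_z (k z.1 * (z.2 <= h z.1)%R%:R) =
  \int[P]_w (k w * h w).
Proof.
move=> mh h01 bk.
have bh : bounded_measurable h.
  by split=> //; exists 1 => w; case/andP: (h01 w) => ? ?; rewrite ger0_norm.
have bg := bounded_measurable_subgraph mh.
pose J1 (k : Om -> R) :=
  \int[uniform_extension]_z (k z.1 * (z.2 <= h z.1)%R%:R).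
pose J2 (k : Om -> R) := \int[P]_w (k w * h w).
apply: (bounded_measurable_functional_ext (J1 := J1) (J2 := J2)) bk.
  move=> J [|] ->; rewrite /J1/J2; split.
  - move=> k1 k2 b1 b2; rewrite -Rintegral_bmD; last 2 first.
    + by apply: bounded_measurableM => //; exact: bounded_measurable_fst.
    + by apply: bounded_measurableM => //; exact: bounded_measurable_fst.
    by apply: eq_Rintegral => z _; rewrite mulrDl.
  - move=> c k1 b1; rewrite -Rintegral_bmZ; last first.
      by apply: bounded_measurableM => //; exact: bounded_measurable_fst.
    by apply: eq_Rintegral => z _; rewrite mulrA.
  - move=> k1 k2 b1 b2 le12; apply: le_Rintegral_bm => [||z].
    + by apply: bounded_measurableM => //; exact: bounded_measurable_fst.
    + by apply: bounded_measurableM => //; exact: bounded_measurable_fst.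
    + by rewrite ler_wpM2r// ?ler0n.
  - move=> k1 k2 b1 b2; rewrite -Rintegral_bmD; last 2 first.
    + exact: bounded_measurableM.
    + exact: bounded_measurableM.
    by apply: eq_Rintegral => z _; rewrite mulrDl.
  - move=> c k1 b1; rewrite -Rintegral_bmZ; last exact: bounded_measurableM.
    by apply: eq_Rintegral => z _; rewrite mulrA.
  - move=> k1 k2 b1 b2 le12; apply: le_Rintegral_bm => [||w].
    + exact: bounded_measurableM.
    + exact: bounded_measurableM.
    + by rewrite ler_wpM2r//; case/andP: (h01 w).
move=> A mA; rewrite /J1 /J2; apply: EFin_inj.
set S := [set z : Om * measurableTypeR R | z.2 <= h z.1].
have mS : measurable S by exact: measurable_subgraph.
have mAT : measurable (A `*` [set: measurableTypeR R]) by exact: measurableX.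
have -> : \int[uniform_extension]_z (\1_A z.1 * (z.2 <= h z.1)%R%:R) =
    \int[uniform_extension]_z (\1_((A `*` setT) `&` S) z).
  apply: eq_Rintegral => z _; rewrite indicI/= !indicE; congr (_ * _).
    by congr (_%:R); congr nat_of_bool; apply/idP/idP;
       rewrite !inE => //= -[].
  by rewrite mem_setE.
rewrite Rintegral_bm_indic; last exact: measurableI.
rewrite EFin_Rintegral; last first.
  by apply: bounded_measurableM => //; exact: bounded_measurable_indic.
rewrite /uniform_extension/= /product_measure1; apply: eq_integral => w _.
rewrite /= indicE; have [wA|wA] := boolP (w \in A).
  rewrite mul1r -(uniform_prob_le (h01 w)); congr (unif _).
  apply/seteqP; split => u /=.
    by move=> /xsectionP[_].
  by move=> uh; apply/xsectionP; split => //; split => //=; exact/set_mem.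
rewrite mul0r -[RHS](measure0 unif); congr (unif _).
apply/seteqP; split => u //= /xsectionP[[/= Aw _] _].
by move: wA; rewrite notin_setE.
Qed.

End UniformExtension.

(** On subsets of [g < f] the two integrals are ordered both ways, so [f] and [g] agree almost
    everywhere on a set where they differ. *)
Lemma ae_le_of_integral d (T : measurableType d) (R : realType)
    (P : probability T R) (f g : T -> R) :
  P.-integrable setT (EFin \o f) -> P.-integrable setT (EFin \o g) ->
  (forall A, measurable A ->
    (\int[P]_(x in A) (f x)%:E <= \int[P]_(x in A) (g x)%:E)%E) ->
  {ae P, forall x, f x <= g x}.
Proof.
move=> fi gi fg.
have mf : measurable_fun setT f by apply/measurable_EFinP; exact: measurable_int fi.
have mg : measurable_fun setT g by apply/measurable_EFinP; exact: measurable_int gi.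
set D := [set x | g x < f x].
have mD : measurable D.
  have -> : D = (fun x => g x < f x) @^-1` [set true] by apply/seteqP; split.
  by rewrite -[X in measurable X]setTI; exact: measurable_fun_ltr.
have : ae_eq P D (EFin \o f) (EFin \o g).
  apply: integral_ae_eq => //.
  - exact: integrableS fi.
  - by apply/measurable_EFinP; exact: measurable_funTS.
  - move=> E ED mE; apply/eqP; rewrite eq_le fg//=.
    apply: le_integral => //; [exact: integrableS gi|exact: integrableS fi|].
    by move=> x /set_mem /ED/ltW; rewrite lee_fin.
apply: filterS => x fx; rewrite leNgt; apply/negP => Dx.
by move: (Dx); have [->] := fx Dx; rewrite ltxx.
Qed.

Lemma bounded_convergence d (T : measurableType d) (R : realType)
    (P : probability T R) (f_ : nat -> T -> R) (f : T -> R) (M : R) :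
  (forall n, measurable_fun setT (f_ n)) ->
  (forall n x, `|f_ n x| <= M) ->
  (forall x, f_ n x @[n --> \oo] --> f x) ->
  bounded_measurable f /\
  (\int[P]_x f_ n x) @[n --> \oo] --> \int[P]_x f x.
Proof.
move=> mf_ fM ff; have bf : bounded_measurable f.
  split; first exact: (measurable_fun_cvg mf_ (fun x _ => ff x)).
  exists M => x.
  have fx : `|f_ n x| @[n --> \oo] --> `|f x| by exact: cvg_norm (ff x).
  rewrite -(cvg_lim (@Rhausdorff R) fx); apply: limr_le; first exact: cvgP fx.
  by apply: nearW => n; exact: fM.
have bf_ n : bounded_measurable (f_ n) by split=> //; exists M.
split=> //; apply/fine_cvg; rewrite (EFin_Rintegral P bf)//=.
have [|||||_ _] := @dominated_convergence _ _ _ P setT measurableT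
    (fun n => EFin \o f_ n) (EFin \o f) (cst M%:E).
- by move=> n; exact/measurable_EFinP.
- by apply/measurable_EFinP; exact: bf.1.
- by apply: aeW => x _; apply/cvg_EFin; [exact: nearW|exact: ff].
- exact: finite_measure_integrable_cst.
- by apply: aeW => x n _; rewrite /= lee_fin fM.
- exact.
Qed.

Lemma integral_extension_fst d (Om : measurableType d) (R : realType)
    (P : probability Om R) (k : Om -> R) : bounded_measurable k ->
  \int[uniform_extension P]_z k z.1 = \int[P]_w k w.
Proof.
pose J1 (k : Om -> R) := \int[uniform_extension P]_z k z.1.
pose J2 (k : Om -> R) := \int[P]_w k w.
apply: (bounded_measurable_functional_ext (J1 := J1) (J2 := J2)).
  move=> J [|] ->; rewrite /J1/J2; split.
  - by move=> k1 k2 b1 b2; rewrite -Rintegral_bmD//; exact: bounded_measurable_fst.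
  - by move=> c k1 b1; rewrite -Rintegral_bmZ//; exact: bounded_measurable_fst.
  - move=> k1 k2 b1 b2 le12; apply: le_Rintegral_bm => //;
    exact: bounded_measurable_fst.
  - by move=> k1 k2 b1 b2; rewrite -Rintegral_bmD.
  - by move=> c k1 b1; rewrite -Rintegral_bmZ.
  - by move=> k1 k2 b1 b2 le12; exact: le_Rintegral_bm.
move=> A mA; rewrite /J1 /J2; apply: EFin_inj.
rewrite [RHS]Rintegral_bm_indic//.
have -> : \int[uniform_extension P]_z (\1_A z.1) =
    \int[uniform_extension P]_z (\1_(A `*` setT) z).
  apply: eq_Rintegral => z _; rewrite !indicE; congr (_%:R); congr nat_of_bool.
  by apply/idP/idP; rewrite !inE => //= -[].
rewrite Rintegral_bm_indic; last exact: measurableX.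
rewrite /uniform_extension/= product_measure1E// -[RHS]mule1; congr (_ * _)%E.
exact: probability_setT.
Qed.

(** * Representation by a randomized quantile map *)

Section MarginalRepresentation.
Context d (Om : measurableType d) (R : realType) (P : probability Om R).
Context (W : set Om) (lo hi : R).
Hypothesis lohi : lo <= hi.

Let Z : set (Om * R) := [set z | W z.1 /\ lo <= z.2 <= hi].

Context (F : (Om * R -> R) -> R).
Hypothesis F_add : forall f g, bounded_on Z f -> bounded_on Z g ->
  F (f + g) = F f + F g.
Hypothesis F_scale : forall a f, bounded_on Z f -> F (a *: f) = a * F f.
Hypothesis F_le : forall f g, bounded_on Z f -> bounded_on Z g ->
  (forall z, Z z -> f z <= g z) -> F f <= F g.
Hypothesis F_marginal : forall h, bounded_measurable h ->
  F (h \o fst) = \int[P]_w h w.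

Let cut (k : Om -> R) c (z : Om * R) : R := k z.1 * (z.2 <= c)%R%:R.

Let bounded_cut k c : bounded_measurable k -> bounded_on Z (cut k c).
Proof.
move=> [_ [M kM]]; exists M => z _; rewrite normrM (le_trans _ (kM z.1))//.
by rewrite normr_nat ler_piMr// lern1 leq_b1.
Qed.

Let bounded_fst (k : Om -> R) : bounded_measurable k -> bounded_on Z (k \o fst).
Proof. by move=> [_ [M kM]]; exists M => z _; exact: kM. Qed.

Let v c A := F (cut \1_A c).

Let bounded0 : bounded_on Z (0 : Om * R -> R).
Proof. by exists 0 => z _; rewrite normr0. Qed.

Let F0 : F 0 = 0.
Proof.
by rewrite -(scale0r (0 : Om * R -> R)) F_scale ?mul0r.
Qed.

Let bounded_indic A c : bounded_on Z (cut \1_A c).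
Proof.
exists 1 => z _; rewrite normrM indicE !normr_nat -natrM lern1.
by case: (_ \in _); case: (_ <= _).
Qed.

Let v_ge0 c A : 0 <= v c A.
Proof.
rewrite -F0; apply: F_le => [||z _]; [exact: bounded0|exact: bounded_indic|].
by rewrite /cut indicE mulr_ge0.
Qed.

Let v_add c A B : measurable A -> measurable B -> A `&` B = set0 ->
  v c (A `|` B) = v c A + v c B.
Proof.
move=> mA mB AB; rewrite /v -F_add; [|exact: bounded_indic..].
congr F; apply/funext => z; rewrite /cut -[RHS]mulrDl; congr (_ * _).
rewrite !indicE in_setU; have [zA|] := boolP (_ \in A); last by rewrite add0r.
have [zB|] := boolP (_ \in B); last by rewrite addr0.
by have : (A `&` B) z.1 by [split; exact/set_mem]; rewrite AB.
Qed.

Let v_le c A : measurable A -> ((v c A)%:E <= P A)%E.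
Proof.
move=> mA; rewrite -Rintegral_bm_indic// lee_fin -F_marginal; last first.
  exact: bounded_measurable_indic.
apply: F_le; first exact: bounded_indic.
  exact/bounded_fst/bounded_measurable_indic.
move=> z _; rewrite /cut /= indicE.
by rewrite -natrM ler_nat; case: (_ \in _); case: (_ <= _).
Qed.

(* The dyadic grids are nested, so a single null set of densities has to be
   corrected and the discretized quantiles decrease in [n]. *)
Let grid n (j : nat) : R := lo + (hi - lo) / 2 ^+ n * j%:R.

Let gridS n j : grid n j = grid n.+1 j.*2.
Proof.
rewrite /grid; congr (_ + _); rewrite exprS invfM -muln2 natrM.
have ? : 2 ^+ n != 0 :> R by rewrite expf_neq0.
by field.
Qed.

Let grid_last n : grid n (2 ^ n) = hi.
Proof.
rewrite /grid natrX divfK ?expf_neq0// subrKC; by [].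
Qed.

Let step_ge0 n : 0 <= (hi - lo) / 2 ^+ n.
Proof. by rewrite divr_ge0// ?subr_ge0// exprn_ge0. Qed.

Let grid_le n j j' : (j <= j')%N -> grid n j <= grid n j'.
Proof. by move=> jj; rewrite /grid lerD2l ler_wpM2l// ler_nat. Qed.

Let grid_itv n j : (j <= 2 ^ n)%N -> lo <= grid n j <= hi.
Proof.
move=> jn; apply/andP; split; first by rewrite /grid lerDl mulr_ge0.
by rewrite -[leRHS](grid_last n) grid_le.
Qed.

Let grid_density : exists h : nat -> nat -> Om -> R,
  [/\ forall n j, measurable_fun setT (h n j),
      forall n j w, 0 <= h n j w <= 1,
      forall n j w, h n j w <= h n j.+1 w,
      forall n j, h n j = h n.+1 j.*2 &
      forall n j A, measurable A -> v (grid n j) A = \int[P]_w (h n j w * \1_A w)].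
Proof.
(* The density is chosen once per cut point [c], not per grid index, so a point common to two grids
   has literally the same density in both. *)
have /choice[g gP] c := dominated_density (v_ge0 c) (@v_add c) (@v_le c).
have mg c : measurable_fun setT (g c) by case: (gP c).
have g01 c w : 0 <= g c w <= 1 by case: (gP c).
have bg c : bounded_measurable (g c).
  by split=> //; exists 1 => w; case/andP: (g01 c w) => ? ?; rewrite ger0_norm.
have gv c A : measurable A -> v c A = \int[P]_w (g c w * \1_A w) by case: (gP c) => _ _; exact.
pose good := \bigcap_n \bigcap_j [set w | g (grid n j) w <= g (grid n j.+1) w].
have mgood : measurable good.
  apply: bigcapT_measurable => n; apply: bigcapT_measurable => j.
  rewrite -[X in measurable X]setTI.
  have -> : [set w | g (grid n j) w <= g (grid n j.+1) w] =
    (fun w => g (grid n j) w <= g (grid n j.+1) w) @^-1` [set true].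
    by apply/seteqP; split.
  exact: measurable_fun_ler.
have good_ae : {ae P, forall w, good w}.
  have : \forall w \ae P, forall n j, g (grid n j) w <= g (grid n j.+1) w.
    apply: ae_foralln => n; apply: ae_foralln => j.
    apply: ae_le_of_integral; [exact: bounded_measurable_integrable..|].
    move=> A mA.
    have gA c : (\int[P]_(x in A) (g c x)%:E = (v c A)%:E)%E.
      rewrite gv// EFin_Rintegral; last first.
        exact/bounded_measurableM/bounded_measurable_indic.
      rewrite integral_mkcond; apply: eq_integral => w _.
      by rewrite patchE indicE; case: ifPn; rewrite ?mulr1 ?mulr0.
    rewrite !gA lee_fin; apply: F_le; [exact: bounded_indic..|].
    move=> z _; rewrite /cut ler_wpM2l ?indicE// ler_nat.
    case: (leP z.2 (grid n j)) => // zj.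
    by rewrite (le_trans zj)// grid_le.
  by apply: filterS => w gw n _ j _; exact: gw.
(* The countably many monotonicity relations hold together off a null set. There every density is
   reset to 1, which preserves both monotonicity in [j] and agreement across nested grids. *)
pose h n j w := if w \in good then g (grid n j) w else 1.
have mh n j : measurable_fun setT (h n j).
  apply: measurable_fun_ifT => //.
  apply: (measurable_fun_bool true); rewrite setTI.
  have -> // : (fun w => w \in good) @^-1` [set true] = good.
  by apply/seteqP; split=> w /=; [exact: set_mem|exact: mem_set].
have h01 n j w : 0 <= h n j w <= 1.
  by rewrite /h; case: ifP => // _; rewrite ler01 lexx.
have bh n j : bounded_measurable (h n j).
  by split=> //; exists 1 => w; case/andP: (h01 n j w) => ? ?; rewrite ger0_norm.
exists h; split => //.
- by move=> n j w; rewrite /h; case: ifPn => // /set_mem; exact.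
- by move=> n j; rewrite /h gridS.
- move=> n j A mA; rewrite gv//; apply: EFin_inj.
  rewrite !EFin_Rintegral; last 2 first.
    exact/bounded_measurableM/bounded_measurable_indic.
    exact/bounded_measurableM/bounded_measurable_indic.
  apply: ae_eq_integral => //.
  + by apply/measurable_EFinP/measurable_funM => //; exact: measurable_indic.
  + by apply/measurable_EFinP/measurable_funM => //; exact: measurable_indic.
  + by apply: filterS good_ae => w gw _; rewrite /h mem_set.
Qed.

(** Both sides are positive and linear in [k] and agree on indicators. *)
Let cut_density h n j : measurable_fun setT (h n j : Om -> R) ->
  (forall w, 0 <= h n j w <= 1) ->
  (forall A, measurable A -> v (grid n j) A = \int[P]_w (h n j w * \1_A w)) ->
  forall k, bounded_measurable k ->
  F (cut k (grid n j)) = \int[P]_w (k w * h n j w).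
Proof.
move=> mh h01 hv k bk.
have bh : bounded_measurable (h n j).
  by split=> //; exists 1 => w; case/andP: (h01 w) => ? ?; rewrite ger0_norm.
pose J1 k := F (cut k (grid n j)).
pose J2 k := \int[P]_w (k w * h n j w).
apply: (bounded_measurable_functional_ext (J1 := J1) (J2 := J2)) bk; last first.
  move=> A mA; rewrite /J1 -/(v _ _) hv//.
  by apply: eq_Rintegral => w _; rewrite mulrC.
move=> J [|] ->; rewrite /J1/J2; split.
- move=> k1 k2 b1 b2; rewrite -F_add; [|exact: bounded_cut..].
  by congr F; apply/funext => z; rewrite /cut mulrDl.
- move=> c k1 b1; rewrite -F_scale; last exact: bounded_cut.
  by congr F; apply/funext => z; rewrite /cut -mulrA.
- move=> k1 k2 b1 b2 le12; apply: F_le => [||z _]; [exact: bounded_cut..|].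
  by rewrite /cut ler_wpM2r.
- move=> k1 k2 b1 b2; rewrite -Rintegral_bmD; last 2 first.
  + exact: bounded_measurableM.
  + exact: bounded_measurableM.
  by apply: eq_Rintegral => z _; rewrite mulrDl.
- move=> c k1 b1; rewrite -Rintegral_bmZ; last exact: bounded_measurableM.
  by apply: eq_Rintegral => z _; rewrite mulrA.
- move=> k1 k2 b1 b2 le12; apply: le_Rintegral_bm => [||w].
  + exact: bounded_measurableM.
  + exact: bounded_measurableM.
  + by rewrite ler_wpM2r//; case/andP: (h01 w).
Qed.

Let F_sum n (f : nat -> Om * R -> R) :
  (forall i, (i < n)%N -> bounded_on Z (f i)) ->
  bounded_on Z (fun z => \sum_(i < n) f i z) /\
  F (fun z => \sum_(i < n) f i z) = \sum_(i < n) F (f i).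
Proof.
elim: n => [_|n IH bf].
  rewrite big_ord0 (_ : (fun z => _) = (0 : Om * R -> R)); first by split.
  by apply/funext => z; rewrite big_ord0.
have [bn Fn] := IH (fun i ni => bf i (ltnW ni)).
rewrite (_ : (fun z => _) = (fun z => \sum_(i < n) f i z) + f n); last first.
  by apply/funext => z; rewrite big_ord_recr.
split; first by apply: bounded_on_add => //; exact: bf.
by rewrite big_ord_recr/= F_add ?Fn//; exact: bf.
Qed.

(** At mesh [n], round a up to the grid under [F], and use the discretized quantile [qn n] under the
    extended law. Abel summation reduces both to the same number [I n], which involves only the
    densities [h n j] and the increments of phi along the grid. As [n] grows, [I n] tends to [F phi]
    by uniform continuity, and to the expectation of phi at [q] by bounded convergence. *)
Lemma marginal_representation : exists q : Om * measurableTypeR R -> R,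
  [/\ measurable_fun setT q, forall z, lo <= q z <= hi &
  forall phi : Om * R -> R,
    (forall a, bounded_measurable (fun w => phi (w, a))) ->
    (exists M, forall z, `|phi z| <= M) ->
    (forall w, continuous (fun a => phi (w, a))) ->
    (forall eps, 0 < eps -> exists2 del, 0 < del & forall w a a', W w ->
      lo <= a <= hi -> lo <= a' <= hi -> `|a - a'| < del ->
      `|phi (w, a) - phi (w, a')| <= eps) ->
    F phi = \int[uniform_extension P]_z phi (z.1, q z)].
Proof.
have [h [mh h01 hS hG hv]] := grid_density.
(* The least [j] with [u <= h n j w], or [2 ^ n] if there is none. The sum stops before the last
   grid point, so u falls to [hi] when no earlier density reaches it. *)
pose cnt n (z : Om * measurableTypeR R) :=
  (\sum_(j < 2 ^ n) (h n j z.1 < z.2)%R)%N.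
pose qn n z := grid n (cnt n z).
have cnt_le n z : (cnt n z <= 2 ^ n)%N.
  rewrite /cnt -[X in (_ <= X)%N]muln1 -[X in (_ <= X * _)%N]card_ord.
  by rewrite -sum_nat_const; apply: leq_sum => i _; exact: leq_b1.
have qn_itv n z : lo <= qn n z <= hi by exact: grid_itv.
(* A coarse index [i] corresponds to the fine indices [2 i] and [2 i + 1]. The first has the same
   density and the second a larger one, so the fine count is at most twice the coarse one. *)
have qn_ni z : nonincreasing_seq (qn ^~ z).
  apply/nonincreasing_seqP => n; rewrite /qn [leRHS]gridS grid_le//.
  rewrite /cnt expnS mul2n (sum_nat_double (fun j => (h n.+1 j z.1 < z.2)%R)).
  rewrite -muln2 big_distrl/=.
  apply: leq_sum => i _; rewrite (hG n i) muln2 -[X in (_ <= X)%N]addnn leq_add2l.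
  have := hS n.+1 i.*2 z.1; case: ltP => // h1; case: ltP => // h2 h3.
  by move: h1; rewrite ltNge (le_trans h2 h3).
have qnE n z : qn n z = lo + (hi - lo) / 2 ^+ n *
    \sum_(j < 2 ^ n) (1 - (z.2 <= h n j z.1)%R%:R).
  rewrite /qn /grid /cnt natr_sum; congr (_ + _ * _).
  by apply: eq_bigr => i _; rewrite ltNge; case: (_ <= _); rewrite /= ?subrr ?subr0.
have mqn n : measurable_fun setT (qn n).
  suff [] : bounded_measurable (qn n) by [].
  rewrite (funext (qnE n)).
  apply: bounded_measurableD; first exact: bounded_measurable_cst.
  apply: bounded_measurableZ; apply: bounded_measurable_sum => j.
  apply: bounded_measurableB; first exact: bounded_measurable_cst.
  exact: bounded_measurable_subgraph.
pose q z := limn (qn ^~ z).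
have qcvg z : qn n z @[n --> \oo] --> q z.
  apply: nonincreasing_is_cvgn => //.
  by exists lo => _ [n _ <-]; case/andP: (qn_itv n z).
exists q; split.
- exact: (measurable_fun_cvg mqn (fun z _ => qcvg z)).
- move=> z; apply/andP; split.
    apply: limr_ge; first exact: cvgP (qcvg z).
    by apply: nearW => n; case/andP: (qn_itv n z).
  apply: limr_le; first exact: cvgP (qcvg z).
  by apply: nearW => n; case/andP: (qn_itv n z).
move=> phi mphi [M phiM] cphi uphi.
pose D n j w := phi (w, grid n j.+1) - phi (w, grid n j).
have bD n j : bounded_measurable (D n j) by exact: bounded_measurableB.
pose I n := \int[P]_w phi (w, hi) -
  \sum_(j < 2 ^ n) \int[P]_w (D n j w * h n j w).
have phi_qn n z : phi (z.1, qn n z) =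
    phi (z.1, hi) - \sum_(j < 2 ^ n) D n j z.1 * (z.2 <= h n j z.1)%R%:R.
  have := telescope_count (p := fun j => z.2 <= h n j z.1)
    (fun j => phi (z.1, grid n j)) (2 ^ n) (fun j zj => le_trans zj (hS n j z.1)).
  rewrite grid_last => <-; congr (phi (_, grid _ _)).
  by apply: eq_bigr => i _; rewrite ltNge.
have bDs n j : bounded_measurable (fun z : Om * measurableTypeR R =>
    D n j z.1 * (z.2 <= h n j z.1)%R%:R).
  apply: bounded_measurableM; first exact: bounded_measurable_fst.
  exact: bounded_measurable_subgraph.
have int_qn n : \int[uniform_extension P]_z phi (z.1, qn n z) = I n.
  under eq_Rintegral do rewrite phi_qn.
  rewrite Rintegral_bmB; last 2 first.
    exact: (bounded_measurable_fst (mphi hi)).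
    exact: bounded_measurable_sum.
  rewrite Rintegral_bm_sum//; congr (_ - _); last first.
    by apply: eq_bigr => j _; rewrite integral_subgraph.
  exact: integral_extension_fst.
have F_cst c : F (fun=> c) = c.
  have := F_marginal (bounded_measurable_cst Om c).
  by rewrite Rintegral_prob_cst.
pose psi n (z : Om * R) := phi (z.1, hi) -
  \sum_(j < 2 ^ n) cut (D n j) (grid n j) z.
have bcut n j : bounded_on Z (cut (D n j) (grid n j)) by exact: bounded_cut.
have bphi : bounded_on Z phi by exists M => z _; exact: phiM.
have bcst c : bounded_on Z (fun=> c : R) by exists `|c|.
have bpsi n : bounded_on Z (psi n).
  have [b1 _] := F_sum (fun j (_ : (j < 2 ^ n)%N) => bcut n j).
  rewrite (_ : psi n = (fun w => phi (w, hi)) \o fst + (-1) *: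
      (fun z => \sum_(j < 2 ^ n) cut (D n j) (grid n j) z)); last first.
    by apply/funext => z; rewrite scaleN1r.
  by apply: bounded_on_add; [exact: bounded_fst|exact: bounded_on_scale].
have F_psi n : F (psi n) = I n.
  have [b1 F1] := F_sum (fun j (_ : (j < 2 ^ n)%N) => bcut n j).
  rewrite (_ : psi n = (fun w => phi (w, hi)) \o fst + (-1) *:
      (fun z => \sum_(j < 2 ^ n) cut (D n j) (grid n j) z)); last first.
    by apply/funext => z; rewrite scaleN1r.
  rewrite F_add; [|exact: bounded_fst|exact: bounded_on_scale].
  rewrite F_scale// mulN1r F1 F_marginal//; congr (_ - _).
  by apply: eq_bigr => j _; apply: cut_density => //; exact: hv.
(* [psi n] is phi with a rounded up to the grid: [telescope_count] again, with a compared to grid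
   points instead of u to densities. *)
have psiE n z : psi n z =
    phi (z.1, grid n (\sum_(j < 2 ^ n) (grid n j < z.2)%R)%N).
  have := telescope_count (p := fun j => z.2 <= grid n j)
    (fun j => phi (z.1, grid n j)) (2 ^ n)
    (fun j zj => le_trans zj (grid_le n (leqnSn j))).
  rewrite grid_last => E; apply: (etrans (esym E)); congr (phi (_, grid _ _)).
  by apply: eq_bigr => i _; rewrite ltNge.
(* [F] passes only to uniform limits: [psi n] is within [eps] of phi on all of [Z] once the mesh is
   below the modulus [del]. *)
have I_F : I n @[n --> \oo] --> F phi.
  apply/cvgrPdist_le => eps e0; have [del d0 del_phi] := uphi _ e0.
  have : (hi - lo) / 2 ^+ n @[n --> \oo] --> 0.
    rewrite (_ : (fun n => _) = geometric (hi - lo) (2^-1)); last first.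
      by apply/funext => n; rewrite /geometric/= exprVn.
    by apply: cvg_geometric; rewrite ger0_norm// invf_lt1// ltr1n.
  move=> /cvgrPdist_lt/(_ _ d0); apply: filterS => n.
  rewrite sub0r normrN ger0_norm// => nd.
  rewrite -F_psi.
  have near_psi z : Z z -> `|phi z - psi n z| <= eps.
    case: z => w a [/= Ww /andP[loa ahi]]; rewrite psiE/=.
    have := @grid_count R lo ((hi - lo) / 2 ^+ n) a (2 ^ n) (step_ge0 n) loa.
    rewrite -/(grid n (2 ^ n)) grid_last => /(_ ahi) /andP[c1 c2].
    apply: del_phi => //; first by rewrite loa.
      apply: grid_itv; rewrite -[X in (_ <= X)%N]muln1.
      rewrite -[X in (_ <= X * _)%N]card_ord -sum_nat_const.
      by apply: leq_sum => i _; exact: leq_b1.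
    rewrite distrC ger0_norm ?subr_ge0// (le_lt_trans _ nd)// lerBlDl.
    exact: c2.
  rewrite ler_distl; apply/andP; split.
    rewrite lerBlDr -[eps]F_cst -F_add//; apply: F_le => //.
      exact: bounded_on_add.
    by move=> z /near_psi; rewrite ler_distl => /andP[+ _]; rewrite lerBlDr.
  rewrite -[eps]F_cst -F_add//; apply: F_le => //.
    exact: bounded_on_add.
  by move=> z /near_psi; rewrite ler_distl => /andP[_].
have [|||_] := bounded_convergence (uniform_extension P)
  (f_ := fun n z => phi (z.1, qn n z)) (f := fun z => phi (z.1, q z)) (M := M).
- move=> n; rewrite (funext (phi_qn n)); apply: measurable_funB.
    exact: (bounded_measurable_fst (mphi hi)).1.
  exact: (bounded_measurable_sum (bDs n)).1.
- by move=> n z; exact: phiM.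
- by move=> z; exact: (continuous_cvg _ (cphi z.1 (q z)) (qcvg z)).
rewrite (funext int_qn) => I_q.
exact: cvg_unique I_F I_q.
Qed.

End MarginalRepresentation.

(** * Borel laws on separable pseudometric spaces *)

HB.instance Definition _ (R : numDomainType) (U V : pseudoPMetricType R) :=
  PseudoMetric.on (U * V)%type.
HB.instance Definition _ (R : numDomainType) (U : pseudoPMetricType R) m n :=
  PseudoMetric.on 'M[U]_(m, n).

Section Separable.
Context (R : realType).

Definition separable (E : pseudoMetricType R) : Prop :=
  exists (I : countType) (s : I -> E),
    forall x e, 0 < e -> exists i, ball x e (s i).

Lemma separable_real : separable R.
Proof.
exists rat, ratr => x e e0; have /rat_in_itvoo[r] : x - e < x + e by lra.
rewrite in_itv/= => /andP[xr rx]; exists r.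
by rewrite -ball_normE/= ltr_distlC xr.
Qed.

Lemma separable_mx m n : separable 'M[R]_(m, n).
Proof.
exists 'M[rat]_(m, n), (map_mx ratr) => x e e0.
have /choice[r rP] : forall ij : 'I_m * 'I_n, exists r : rat,
    ball (x ij.1 ij.2) e (ratr r).
  move=> ij; have /rat_in_itvoo[r] : x ij.1 ij.2 - e < x ij.1 ij.2 + e by lra.
  rewrite in_itv/= => /andP[xr rx]; exists r.
  by rewrite -ball_normE/= ltr_distlC xr.
exists (\matrix_(i, j) r (i, j)); split=> // i j.
by rewrite !mxE; exact: (rP (i, j)).
Qed.

Lemma separable_prod (E1 E2 : pseudoMetricType R) :
  separable E1 -> separable E2 -> separable (E1 * E2)%type.
Proof.
move=> [I [s Is]] [J [t Jt]].
exists (I * J)%type, (fun ij => (s ij.1, t ij.2)) => -[x y] e e0.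
have [i si] := Is x e e0; have [j tj] := Jt y e e0.
by exists (i, j).
Qed.

(** The sets are balls of radius [1 / (m + 1)] around the countable family, enumerated through
    [pickle]. Interiors appear because a [ball] of a pseudometric type need not be open. *)
Lemma separable_basis (E : pseudoMetricType R) : separable E ->
  exists B : nat -> set E, (forall n, B n = set0 \/ exists c e, B n = ball c e) /\
    forall U x, open U -> U x -> exists2 n, (B n)° x & B n `<=` U.
Proof.
move=> [I [s Is]].
pose B n : set E := if @unpickle (I * nat)%type n is Some (i, m)
  then ball (s i) m.+1%:R^-1 else set0.
exists B; split.
  move=> n; rewrite /B; case: unpickle => [[i m]|]; last by left.
  by right; exists (s i), m.+1%:R^-1.
move=> U x oU Ux.
have [e e0 xeU] : exists2 e, 0 < e & ball x e `<=` U.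
  have /nbhs_ballP[e /= e0 xe] : nbhs x U by exact: open_nbhs_nbhs.
  by exists e.
have e2 : 0 < e / 2 by rewrite divr_gt0.
have [m me] : exists m, m.+1%:R^-1 < e / 2.
  exists (Num.bound (e / 2)^-1); rewrite invf_plt ?posrE//.
  apply: lt_trans (archi_boundP _) _; first by rewrite invr_ge0 ltW.
  by rewrite ltr_nat.
set r : R := m.+1%:R^-1.
have r0 : 0 < r by rewrite invr_gt0.
have [i xi] := Is x (r / 2) (divr_gt0 r0 (ltr0Sn _ 1)).
exists (pickle (i, m)); rewrite /B pickleK.
  apply/nbhs_ballP; exists (r / 2) => [|y xy]; first by rewrite /= divr_gt0.
  by rewrite -/r (splitr r); apply: ball_triangle xy; exact: ball_sym.
move=> y siy; apply: xeU; apply: (@le_ball _ _ _ (r / 2 + r)).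
  by rewrite -/r in me; lra.
exact: ball_triangle xi siy.
Qed.

(** A criterion that can be checked coordinatewise, since the balls of products and matrices are
    products of balls. *)
Definition ball_measurable d (T : measurableType d) (E : pseudoMetricType R)
    (f : T -> E) : Prop :=
  forall c e, measurable (f @^-1` ball c e).

Lemma ball_measurable_real d (T : measurableType d) (f : T -> R) :
  measurable_fun setT f -> ball_measurable f.
Proof.
by move=> mf c e; rewrite -[X in measurable X]setTI; apply: mf => //;
  exact: measurable_ball.
Qed.

Lemma ball_measurable_mx d (T : measurableType d) m n (f : T -> 'M[R]_(m, n)) :
  (forall i j, measurable_fun setT (fun t => f t i j)) -> ball_measurable f.
Proof.
(* A ball of matrices carries the condition [0 < e], so nonpositive radii give the empty set and not
   an intersection of coordinate balls. *)
move=> mf c e; have [e0|e0] := ltP 0 e; last first.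
  rewrite (_ : _ @^-1` _ = set0)//; apply/seteqP; split=> t //= -[].
  by rewrite ltNge e0.
rewrite (_ : _ @^-1` _ = \bigcap_(ij in [set: 'I_m * 'I_n])
  ((fun t => f t ij.1 ij.2) @^-1` ball (c ij.1 ij.2) e)).
  apply: fin_bigcap_measurable; first exact: finite_finset.
  by move=> ij _; exact: (ball_measurable_real (mf _ _)).
apply/seteqP; split=> t /=.
  by move=> [_ ft] [i j] _; exact: ft.
by move=> ft; split=> // i j; exact: (ft (i, j) I).
Qed.

Lemma ball_measurable_pair d (T : measurableType d) (E1 E2 : pseudoMetricType R)
    (f : T -> E1) (g : T -> E2) :
  ball_measurable f -> ball_measurable g ->
  ball_measurable (fun t => (f t, g t)).
Proof. by move=> mf mg c e; exact: (measurableI _ _ (mf c.1 e) (mg c.2 e)). Qed.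

(* The measurable structure of [borel] is generated by all open sets, even on a
   product; separability reduces it to countably many balls. *)
Lemma measurable_fun_borel d (T : measurableType d) (E : pseudoPMetricType R)
    (f : T -> E) : separable E -> ball_measurable f ->
  measurable_fun setT (f : T -> borel E).
Proof.
move=> /separable_basis[B [Bball Bbasis]] mf.
have sG : @measurable _ (borel E) = <<s @open E >> by [].
apply: (@measurability _ _ T (borel E) setT f _ sG) => // _ [U oU <-]; rewrite setTI.
rewrite (_ : f @^-1` U = \bigcup_(n in [set n | B n `<=` U]) f @^-1` B n).
  apply: bigcup_measurable => n _; have [->|[c [e ->]]] := Bball n; last exact: mf.
  by rewrite preimage_set0.
apply/seteqP; split=> t /=; last by move=> [n BU]; exact: BU.
by move=> /(Bbasis _ _ oU)[n /interior_subset Bt BU]; exists n.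
Qed.

Lemma measurable_open (E : ptopologicalType) (U : set E) : open U ->
  measurable (U : set (borel E)).
Proof. by move=> oU; exact: sub_sigma_algebra. Qed.

Lemma measurable_closed (E : ptopologicalType) (U : set E) : closed U ->
  measurable (U : set (borel E)).
Proof.
by move=> cU; rewrite -[U]setCK; apply: measurableC; apply: measurable_open;
  exact: closed_openC.
Qed.

Lemma continuous_borel_measurable (E F : ptopologicalType) (f : E -> F) :
  continuous f -> measurable_fun setT (f : borel E -> borel F).
Proof.
move=> cf; have sG : @measurable _ (borel F) = <<s @open F >> by [].
apply: (@measurability _ _ (borel E) (borel F) setT f _ sG) => // _ [U oU <-]; rewrite setTI.
by apply: measurable_open; exact: open_comp.
Qed.

Lemma continuous_real_measurable (E : ptopologicalType) (f : E -> R) :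
  continuous f -> measurable_fun setT (f : borel E -> R).
Proof.
move=> cf; apply: (measurability _ (RGenOInfty.measurableE R)) => //.
move=> _ [_ [x ->] <-]; rewrite setTI.
by apply: measurable_open; apply: open_comp => //; exact: interval_open.
Qed.

Section Support.
Context (E : pseudoPMetricType R) (sepE : separable E).
Context (P : probability (borel E) R).

Lemma law_support_closed : closed (law_support P : set E).
Proof.
rewrite -openC (_ : ~` _ = \bigcup_(U in [set U : set E | open U /\ P U = 0%E]) U).
  by apply: bigcup_open => U [].
apply/seteqP; split => x /=.
  move=> /existsNP[U /not_implyP[oU /not_implyP[Ux /negP]]].
  rewrite -leNgt => PU; exists U => //; split=> //.
  by apply/eqP; rewrite eq_le PU/=; exact: measure_ge0.
by move=> [U [oU PU] Ux] /(_ U oU Ux); rewrite PU ltxx.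
Qed.

Lemma law_support_measurable : measurable (law_support P : set (borel E)).
Proof. by apply: measurable_closed; exact: law_support_closed. Qed.

(** A point off the support has a null open neighbourhood, hence lies in a null interior of a basis
    set, and there are countably many of those. *)
Lemma law_support_full : P (~` law_support P) = 0%E.
Proof.
have [B [_ Bbasis]] := separable_basis sepE.
have mC : measurable (~` law_support P : set (borel E)).
  by apply: measurableC; exact: law_support_measurable.
suff nP : P.-negligible (~` law_support P) by exact: measure_negligible.
pose N n : set (borel E) := if P (B n)° == 0%E then (B n)° else set0.
apply: (@negligibleS _ _ _ _ (\bigcup_n N n)); last first.
  apply: negligible_bigcup => n; rewrite /N.
  case: ifPn => [/eqP P0|_]; last exact: negligible_set0.
  by apply/negligibleP => //; apply: measurable_open; exact: open_interior.
move=> x /existsNP[U /not_implyP[oU /not_implyP[Ux /negP]]].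
rewrite -leNgt => PU; have [n Bx BU] := Bbasis _ _ oU Ux.
exists n => //; rewrite /N ifT// eq_le measure_ge0 andbT (le_trans _ PU)//.
apply: le_measure; rewrite ?inE.
- by apply: measurable_open; exact: open_interior.
- exact: measurable_open.
- by apply: subset_trans BU; exact: interior_subset.
Qed.

Lemma law_support_ae : {ae P, forall x, law_support P x}.
Proof.
exists (~` law_support P : set (borel E)); split => //.
  by apply: measurableC; exact: law_support_measurable.
exact: law_support_full.
Qed.

End Support.

End Separable.

Lemma increasing_approx d (T : measurableType d) (R : realType)
    (P : probability T R) (A : set T) (G : nat -> set T) (eps : R) :
  0 < eps -> (forall n, measurable (G n)) -> nondecreasing_seq G ->
  \bigcup_n G n = A -> exists n, (P (A `\` G n) <= eps%:E)%E.
Proof.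
move=> e0 mG ndG GA.
have mA : measurable A by rewrite -GA; exact: bigcupT_measurable.
have mAG n : measurable (A `\` G n) by exact: measurableD.
have cap0 : \bigcap_n (A `\` G n) = set0.
  rewrite -subset0 => x Ax; have [Ax0 _] := Ax O I.
  by move: Ax0; rewrite -GA => -[n _ Gnx]; have [_] := Ax n I.
have : P (A `\` G n) @[n --> \oo] --> 0%E.
  rewrite -(measure0 P) -cap0; apply: nonincreasing_cvg_mu => //.
  - by rewrite ltey_eq fin_num_measure.
  - by rewrite cap0.
  - by move=> m n mn; apply/subsetPset; apply: setDS; exact/subsetPset/ndG.
move=> /fine_cvgP[_ /cvgrPdist_le/(_ _ e0)] [N _ /(_ N (leqnn N))] /=.
rewrite sub0r normrN ger0_norm ?fine_ge0// => PN; exists N.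
by rewrite -(@fineK _ (P _)) ?lee_fin// fin_num_measure.
Qed.

(** * Regularity of Borel laws and continuous test functions *)

Section Regularity.
Context (R : realType) (E : pseudoPMetricType R) (P : probability (borel E) R).

(** The sets are the closures of the points whose ball of radius [1 / (n + 1)] stays in [U]. By
    symmetry of balls, a limit of such points lies in the ball of one of them, hence in [U]. *)
Lemma open_increasing_closed (U : set E) : open U ->
  exists G : nat -> set E, [/\ forall n, closed (G n),
    nondecreasing_seq G & \bigcup_n G n = U].
Proof.
move=> oU; pose V n := [set x : E | ball x n.+1%:R^-1 `<=` U].
have r0 n : 0 < n.+1%:R^-1 :> R by rewrite invr_gt0.
exists (fun n => closure (V n)); split.
- by move=> n; exact: closed_closure.
- move=> m n mn; apply/subsetPset; apply: closureS => x Vx y xy; apply: Vx.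
  by apply: le_ball xy; rewrite lef_pV2 ?posrE// ler_nat.
- apply/seteqP; split=> [x [n _ Vx]|x Ux].
    have [y [Vy xy]] := Vx _ (nbhsx_ballx x _ (r0 n)).
    by apply: Vy; exact: ball_sym.
  have /nbhs_ballP[e /= e0 xe] : nbhs x U by exact: open_nbhs_nbhs.
  exists (Num.bound e^-1) => //; apply: subset_closure => y xy; apply: xe.
  apply: le_ball xy; rewrite invf_ple ?posrE//.
  apply/ltW/(lt_trans (archi_boundP _)); first by rewrite invr_ge0 ltW.
  by rewrite ltr_nat.
Qed.

(** The sets with closed inner and open outer approximations form a sigma-algebra, and it contains
    the open sets because these are increasing unions of closed sets. *)
Lemma borel_regular (A : set (borel E)) (eps : R) : measurable A -> 0 < eps ->
  exists C U : set E, [/\ closed C, open U, C `<=` A, A `<=` U &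
    (P (U `\` C) <= eps%:E)%E].
Proof.
pose M := [set A : set E | forall eps : R, 0 < eps -> exists C U : set E,
  [/\ closed C, open U, C `<=` A, A `<=` U & (P (U `\` C) <= eps%:E)%E]].
suff sM : <<s @open E >> `<=` M by move=> mA e0; exact: (sM A mA eps e0).
apply: smallest_sub => [|U oU e e0]; last first.
  have [G [cG ndG GU]] := open_increasing_closed oU.
  have [|n Pn] := @increasing_approx _ (borel E) R P U G e e0 _ ndG GU.
    by move=> n; exact: measurable_closed.
  exists (G n), U; split => //.
  by rewrite -GU => x Gx; exists n.
split.
- move=> e e0; exists set0, set0; split => //.
  + exact: closed0.
  + exact: open0.
  + by rewrite setD0 measure0 lee_fin ltW.
- move=> B MB e /MB[C [U [cC oU CB BU Pe]]]; exists (~` U), (~` C); split.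
  + exact: open_closedC.
  + exact: closed_openC.
  + by move=> x Ux; split => // /BU.
  + by move=> x [_ Bx] /CB.
  + by rewrite setDE setCK setIC -setDE.
move=> B MB e e0; have e2 : 0 < e / 2 by rewrite divr_gt0.
have /choice[CU CUP] n : exists CU : set E * set E,
    [/\ closed CU.1, open CU.2, CU.1 `<=` B n, B n `<=` CU.2 &
        (P (CU.2 `\` CU.1) <= (e / 2 / (2 ^ n.+1)%:R)%:E)%E].
  have [|C [U h]] := MB n (e / 2 / (2 ^ n.+1)%:R); last by exists (C, U).
  by rewrite divr_gt0// ltr0n expn_gt0.
have mC n : measurable ((CU n).1 : set (borel E)).
  by case: (CUP n) => + *; exact: measurable_closed.
have mU n : measurable ((CU n).2 : set (borel E)).
  by case: (CUP n) => _ + *; exact: measurable_open.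
pose G n : set E := \bigcup_(i < n) (CU i).1.
have mG n : measurable (G n : set (borel E)) by exact: bigcup_measurable.
set Cs : set (borel E) := \bigcup_n (CU n).1.
set Us : set (borel E) := \bigcup_n (CU n).2.
have mCs : measurable Cs by exact: bigcupT_measurable.
have mUs : measurable Us by exact: bigcupT_measurable.
(* The countable union of the inner sets need not be closed: a finite stage of it costs the second
   half of [e], the first being spread geometrically over the [B n]. *)
have [||n Pn] := @increasing_approx _ (borel E) R P Cs G (e / 2) e2 mG.
- move=> i j ij; apply/subsetPset => x [k /= ki Cx]; exists k => //=.
  exact: leq_trans ij.
- apply/seteqP; split=> [x [k _ [i _ Cx]]|x [k _ Cx]]; first by exists i.
  by exists k.+1 => //; exists k => /=.
exists (G n), Us; split.
- apply: closed_bigcup; first exact: finite_II.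
  by move=> i _; case: (CUP i).
- by apply: bigcup_open => i _; case: (CUP i).
- by move=> x [i _ Cx]; exists i => //; case: (CUP i) => _ _ + _ _; exact.
- by move=> x [i _ Bx]; exists i => //; case: (CUP i) => _ _ _ + _; exact.
have mUC : measurable (Us `\` Cs) by exact: measurableD.
have mCG : measurable (Cs `\` G n) by exact: measurableD.
apply: (@le_trans _ _ (P ((Us `\` Cs) `|` (Cs `\` G n)))).
  apply: le_measure; rewrite ?inE; [exact: measurableD|exact: measurableU|].
  move=> x [Ux Gx]; have [Cx|Cx] := pselect (Cs x); first by right.
  by left.
have PU2 : (P ((Us `\` Cs) `|` (Cs `\` G n)) <= P (Us `\` Cs) + P (Cs `\` G n))%E.
  exact: measureU2.
apply: (le_trans PU2).
rewrite (splitr e) EFinD; apply: leeD => //.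
apply: (@le_trans _ _ (\sum_(n <oo) P ((CU n).2 `\` (CU n).1))%E).
  apply: measure_sigma_subadditive => //.
    by move=> i; exact: measurableD.
  move=> x [[i _ Ux] Cx]; exists i => //; split => // Cix.
  by apply: Cx; exists i.
apply: le_trans (epsilon_trick0 _ (ltW e2)).
by apply: lee_nneseries => // i _; case: (CUP i).
Qed.

End Regularity.

(** Regularity of the law of [V] squeezes [C] between a closed [F] and an open [U]. The Urysohn
    function of the pair differs from the indicator of [C] only on [U] minus [F], and there by at
    most 1, so the error is the bound of [psi] times a small probability. *)
Lemma continuous_test_ge0 d (T : measurableType d) (R : realType)
    (P : probability T R) (E : pseudoPMetricType R) (V : T -> borel E)
    (psi : T -> R) (C : set (borel E)) :
  measurable_fun setT V -> bounded_measurable psi ->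
  (forall f : E -> R, continuous f -> (forall x, 0 <= f x <= 1) ->
     0 <= \int[P]_z (f (V z) * psi z)) ->
  measurable C -> 0 <= \int[P]_z (\1_C (V z) * psi z).
Proof.
move=> mV bpsi test mC; have [_ [M psiM]] := bpsi.
pose Vm : {mfun T >-> borel E} := mfun_Sub (mem_set mV).
pose Q : probability (borel E) R := distribution P Vm.
have QE A : Q A = P (V @^-1` A) by [].
have bfV (f : E -> R) : continuous f -> (forall x, 0 <= f x <= 1) ->
    bounded_measurable (fun z => f (V z)).
  move=> cf f01; split.
    by apply: measurableT_comp => //; exact: continuous_real_measurable.
  by exists 1 => z; case/andP: (f01 (V z)) => ? ?; rewrite ger0_norm.
have b1V A : measurable A -> bounded_measurable (fun z => \1_A (V z) : R).
  move=> mA; split; first by apply: measurableT_comp => //; exact: measurable_indic.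
  by exists 1 => z; rewrite indicE; case: (_ \in _); rewrite ?normr1 ?normr0.
have M0 : 0 <= Num.max M 0 by rewrite le_max lexx orbT.
apply/ler_addgt0Pl => eps e0; rewrite addrC -lerBlDr sub0r.
set K := Num.max M 0 + 1.
have K0 : 0 < K by rewrite ltr_wpDl.
have [F [U [cF oU FC CU QUF]]] := borel_regular Q mC (divr_gt0 e0 K0).
have FU0 : F `&` ~` U = set0.
  by rewrite -subset0 => x [Fx Ux]; apply: Ux; apply: CU; exact: FC.
have mU := measurable_open oU; have mF := measurable_closed cF.
have mUF : measurable (U `\` F : set (borel E)) by exact: measurableD.
have sep : uniform_separator (~` U) F.
  apply: normal_uniform_separator; [exact: pseudometric_normal| | |].
  - exact: open_closedC.
  - exact: cF.
  - by rewrite setIC.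
pose f := Urysohn (R := R) (~` U) F.
have cf : continuous f by exact: Urysohn_continuous.
have f01 x : 0 <= f x <= 1.
  have := @Urysohn_range _ R (~` U) F (f x); rewrite /= in_itv/=; apply.
  by exists x.
have f0 x : ~ U x -> f x = 0 by move=> Ux; apply: (Urysohn_sub0 sep); exists x.
have f1 x : F x -> f x = 1 by move=> Fx; apply: (Urysohn_sub1 sep); exists x.
have fC x : `|f x - \1_C x| <= \1_(U `\` F) x.
  rewrite !indicE; have [Fx|Fx] := pselect (F x).
    by rewrite (mem_set (FC _ Fx)) f1// subrr normr0.
  have [Ux|Ux] := pselect (U x).
    rewrite (mem_set (conj Ux Fx : (U `\` F) x)).
    have := f01 x; case: (_ \in _) => /andP[fx0 fx1]; last by rewrite subr0 ger0_norm.
    by rewrite distrC ger0_norm ?subr_ge0// lerBlDr lerDl.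
  have Cx : x \notin C by rewrite notin_setE => /CU.
  by rewrite (negbTE Cx) f0// subrr normr0.
have bUF := b1V _ mUF; have bC := b1V _ mC; have bf := bfV _ cf f01.
have mVUF : measurable (V @^-1` (U `\` F)).
  by rewrite -[X in measurable X]setTI; apply: (mV).
have UFe : \int[P]_z (\1_(U `\` F) (V z)) <= eps / K.
  by rewrite -lee_fin EFin_Rintegral// -[X in (X <= _)%E]/(\int[P]_z (\1_(V @^-1` (U `\` F)) z)%:E)%E
    integral_indic ?setIT.
have -> : - eps = 0 - K * (eps / K) by rewrite sub0r mulrC divfK// gt_eqF.
apply: (@le_trans _ _ (\int[P]_z (f (V z) * psi z) -
    K * \int[P]_z (\1_(U `\` F) (V z)))).
  by rewrite lerB ?test// ler_pM2l.
rewrite -Rintegral_bmZ// -Rintegral_bmB; last 2 first.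
  exact: bounded_measurableM.
  exact: bounded_measurableZ.
apply: le_Rintegral_bm => [||z].
- by apply: bounded_measurableB; [exact: bounded_measurableM|exact: bounded_measurableZ].
- exact: bounded_measurableM.
- rewrite lerBlDr -lerBlDl -mulrBl (le_trans (ler_norm _))// normrM mulrC.
  apply: ler_pM => //.
  by apply: le_trans (psiM z) _; rewrite /K; have := le_max M M 0; rewrite lexx; lra.
Qed.

(** Compactness is used as near covering: a property that holds for all small [del] near each point
    of [W] times the segment holds with one range of [del] on the whole set. *)
Lemma compact_uniformly_continuous_r (R : realType) (E : pseudoMetricType R)
    (W : set E) (lo hi : R) (phi : E * R -> R) : compact W -> continuous phi ->
  forall eps, 0 < eps -> exists2 del, 0 < del & forall w a a', W w ->
    lo <= a <= hi -> lo <= a' <= hi -> `|a - a'| < del ->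
    `|phi (w, a) - phi (w, a')| <= eps.
Proof.
move=> cW cphi eps e0.
have cWK : compact (W `*` `[lo, hi]%classic).
  by apply: compact_setX => //; exact: segment_compact.
pose Q (del : R) (p : E * R) := forall a', `|p.2 - a'| < del ->
  `|phi p - phi (p.1, a')| <= eps.
have := (compact_near_coveringP _).1 cWK R (0^'+) Q _.
case=> [p _|del /= d0 Qd].
  have e2 : 0 < eps / 2 by rewrite divr_gt0.
  have /cvgrPdist_lt/(_ _ e2)/nbhs_ballP[r /= r0 pr] := cphi p.
  have r2 : 0 < r / 2 by rewrite divr_gt0.
  near=> p' del.
  have pp' : ball p (r / 2) p' by near: p'; exact: nbhsx_ballx.
  have dr : del < r / 2 by near: del; exact: nbhs_right_lt.
  move=> a' pa'.
  have p'a' : ball p' (r / 2) (p'.1, a').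
    split; first exact: ballxx.
    by rewrite -ball_normE/=; exact: lt_trans pa' dr.
  have h1 : `|phi p - phi p'| < eps / 2.
    by apply: pr; apply: le_ball pp'; rewrite ler_pdivrMr// ler_pMr// ler1n.
  have h2 : `|phi p - phi (p'.1, a')| < eps / 2.
    by apply: pr; rewrite (splitr r); exact: ball_triangle pp' p'a'.
  rewrite (le_trans (ler_distD (phi p) _ _))// [leRHS](splitr eps).
  by rewrite lerD ?(ltW h2)// distrC ltW.
(* The property is known for radii strictly below [del], hence the half. *)
exists (del / 2); first by rewrite divr_gt0.
move=> w a a' Ww aK _ aa'; apply: (Qd (del / 2) _ _ (w, a)) => //=.
- by rewrite sub0r normrN gtr0_norm ?divr_gt0// ltr_pdivrMr// ltr_pMr// ltr1n.
- by rewrite divr_gt0.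
Unshelve. all: by end_near. Qed.

(** * Versions of conditional probabilities *)

Section ConditionalProbability.
Context d d' (Om : measurableType d) (S : measurableType d') (R : realType).
Context (P : probability Om R) (E : set Om) (V : Om -> S).
Hypotheses (mE : measurable E) (mV : measurable_fun setT V).

(** The version is the density of [C] |-> P(E and V in [C]) with respect to the law of [V], which
    dominates it. Bounds tested on all [C] become almost sure bounds on this density and are pulled
    back along [V]. *)
Lemma cond_prob_exists : exists g : S -> R,
  [/\ cond_prob_version P E V g,
   (forall tau : R, (forall C, measurable C ->
      (tau%:E * P (V @^-1` C) <= P (E `&` V @^-1` C))%E) ->
      {ae P, forall z, tau <= g (V z)}) &
   (forall tau : R, (forall C, measurable C ->
      (P (E `&` V @^-1` C) <= tau%:E * P (V @^-1` C))%E) ->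
      {ae P, forall z, g (V z) <= tau})].
Proof.
pose Vm : {mfun Om >-> S} := mfun_Sub (mem_set mV).
pose Q : probability S R := distribution P Vm.
have mVC C : measurable C -> measurable (V @^-1` C).
  by move=> mC; rewrite -[X in measurable X]setTI; apply: (mV).
have mEVC C : measurable C -> measurable (E `&` V @^-1` C).
  by move=> mC; apply: measurableI => //; exact: mVC.
pose v C := fine (P (E `&` V @^-1` C)).
have vE C : measurable C -> (v C)%:E = P (E `&` V @^-1` C).
  by move=> mC; rewrite /v fineK// fin_num_measure//; exact: mEVC.
have [||C mC|g [mg g01 gE]] := @dominated_density _ _ _ Q v.
- by move=> C; rewrite /v fine_ge0.
- move=> A B mA mB AB; apply: EFin_inj; rewrite EFinD !vE//; last exact: measurableU.
  rewrite preimage_setU setIUr measureU//; [exact: mEVC|exact: mEVC|].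
  apply/seteqP; split=> x // -[[_ Ax] [_ Bx]].
  by have : (A `&` B) (V x) by []; rewrite AB.
- rewrite vE//; apply: le_measure; rewrite ?inE; [exact: mEVC|exact: mVC|].
  exact: subIsetr.
have bg : bounded_measurable g.
  by split=> //; exists 1 => w; case/andP: (g01 w) => ? ?; rewrite ger0_norm.
have bgV : bounded_measurable (g \o V).
  split; first exact: measurableT_comp.
  by case: bg => _ [M gM]; exists M => z; exact: gM.
have intg C : measurable C -> (\int[Q]_(x in C) (g x)%:E = (v C)%:E)%E.
  move=> mC; rewrite gE// EFin_Rintegral; last first.
    exact/bounded_measurableM/bounded_measurable_indic.
  rewrite integral_mkcond; apply: eq_integral => x _.
  by rewrite patchE indicE; case: ifPn; rewrite ?mulr1 ?mulr0.
have pull (A : set S) : {ae Q, forall x, A x} -> {ae P, forall z, A (V z)}.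
  move=> [N [mN QN AN]]; exists (V @^-1` N); split => //; first exact: mVC.
  by move=> z Az; exact: AN.
have int_cst tau C : measurable C ->
    (\int[Q]_(x in C) (tau%:E : \bar R) = tau%:E * P (V @^-1` C))%E.
  by move=> mC; rewrite integral_cst.
exists g; split.
- split => //; first exact: bounded_measurable_integrable.
  move=> C mC; rewrite -vE// -intg//.
  rewrite -[RHS]/(\int[pushforward P V]_(x in C) (EFin \o g) x)%E.
  rewrite ge0_integral_pushforward//.
    by apply/measurable_EFinP; exact: measurable_funTS.
  by move=> x _; rewrite lee_fin; case/andP: (g01 x).
- move=> tau tauP; apply: (pull [set x | tau <= g x]).
  apply: (@ae_le_of_integral _ _ _ Q (fun=> tau) g).
  + exact/bounded_measurable_integrable/bounded_measurable_cst.
  + exact: bounded_measurable_integrable.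
  + by move=> C mC; rewrite int_cst// intg// vE// tauP.
- move=> tau tauP; apply: (pull [set x | g x <= tau]).
  apply: (@ae_le_of_integral _ _ _ Q g (fun=> tau)).
  + exact: bounded_measurable_integrable.
  + exact/bounded_measurable_integrable/bounded_measurable_cst.
  + by move=> C mC; rewrite int_cst// intg// vE// tauP.
Qed.

End ConditionalProbability.

Lemma continuous_pair (E F1 F2 : topologicalType) (f : E -> F1) (g : E -> F2) :
  continuous f -> continuous g -> continuous (fun z => (f z, g z)).
Proof.
move=> cf cg z.
exact: (cvg_pair (G := nbhs (f z)) (H := nbhs (g z)) (cf z) (cg z)).
Qed.

(** * From dual nonnegativity to an admissible law *)

Section ModelFacts.
Context (R : realType) (T k : nat).
Local Notation obsT := ('cV[R]_T * 'M[R]_(T, k))%type.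
Local Notation condT := ('M[R]_(T, k) * R)%type.

Lemma outcome_coord_continuous (t : 'I_T) :
  continuous (fun w : obsT => w.1 t 0).
Proof.
by move=> w; apply: (@continuous_comp _ _ _ fst (fun y : 'cV[R]_T => y t 0));
  [exact: cvg_fst|exact: coord_continuous].
Qed.

Lemma fitted_coord_continuous (b : 'cV[R]_k) (t : 'I_T) :
  continuous (fun w : obsT => (w.2 *m b) t 0).
Proof.
rewrite (_ : (fun w : obsT => (w.2 *m b) t 0) =
  (fun w : obsT => \sum_j w.2 t j * b j 0)); last first.
  by apply/funext => v; rewrite mxE.
apply: (@continuous_big _ _ +%R 0 xpredT (@add_continuous R^o) obsT _
  (fun j (w : obsT) => w.2 t j * b j 0)) => j _ w.
apply: continuousM; last exact: cvg_cst.
by apply: (@continuous_comp _ _ _ snd (fun y : 'M[R]_(T, k) => y t j));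
  [exact: cvg_snd|exact: coord_continuous].
Qed.

Lemma resid_continuous (b : 'cV[R]_k) (t : 'I_T) :
  continuous (fun w : obsT => resid b w t).
Proof.
move=> w; apply: continuousB; first exact: outcome_coord_continuous.
exact: fitted_coord_continuous.
Qed.

Lemma separable_obs : separable (obsT : pseudoPMetricType R).
Proof. by apply: separable_prod; exact: separable_mx. Qed.

Context (Pobs : probability (borel obsT) R) (b : 'cV[R]_k) (tau : R).
Local Notation W := (obs_support Pobs).

Lemma obs_support_nonempty : W !=set0.
Proof.
apply/set0P/negP => /eqP W0.
have := law_support_full separable_obs Pobs.
rewrite -/(obs_support Pobs) W0 setC0.
by have -> : Pobs setT = 1%E := probability_setT Pobs; move=> /eqP; rewrite onee_eq0.
Qed.

Lemma reg_support_snd (w : obsT) : W w -> reg_support Pobs w.2.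
Proof.
move=> Ww U oU Uw; apply: (Ww (snd @^-1` U)) => //.
by apply: open_comp => // x _; exact: cvg_snd.
Qed.

Hypothesis W_compact : compact W.
Hypothesis T_ge1 : (1 <= T)%N.
Hypothesis tau01 : 0 < tau < 1.

Lemma resid_bounded : exists M, forall w t, W w -> `|resid b w t| <= M.
Proof.
have /choice[M Mt] (t : 'I_T) : exists M, forall w, W w -> `|resid b w t| <= M.
  have : compact ((fun w : obsT => resid b w t) @` W).
    apply: continuous_compact => //.
    by apply: continuous_subspaceT; exact: resid_continuous.
  move=> /compact_bounded[M [_ MP]]; exists (M + 1) => w Ww.
  by apply: (MP (M + 1)); [rewrite ltrDl|exists w].
exists (\sum_t `|M t|) => w t Ww; apply: le_trans (Mt t w Ww) _.
rewrite (bigD1 t)//= (le_trans (ler_norm _))// lerDl.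
by apply: sumr_ge0.
Qed.

Lemma resid_in_K (w : obsT) t : W w -> K_int Pobs b (resid b w t).
Proof.
move=> Ww; have [M rM] := resid_bounded.
rewrite /K_int /=; apply/andP; split.
  apply: ge_inf; last by exists w, t.
  by exists (- M) => _ [v [s [Wv ->]]]; apply: lerNnormlW; exact: rM.
apply: sup_ubound; last by exists w, t.
by exists M => _ [v [s [Wv ->]]]; apply: le_trans (ler_norm _) (rM _ _ Wv).
Qed.

Lemma K_lo_le_hi : K_lo Pobs b <= K_hi Pobs b.
Proof.
have [w Ww] := obs_support_nonempty.
by have /andP[] := resid_in_K (Ordinal T_ge1) Ww; exact: le_trans.
Qed.

Lemma indicator_sub_bound (c : bool) : `|c%:R - tau| <= 1.
Proof.
have /andP[t0 t1] := tau01.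
by case: c; rewrite ler_norml /=; apply/andP; split; lra.
Qed.

Lemma S_dual_bound (lam : multiplier R T k) (w : obsT) a M :
  (forall t s, `|lam t s w.2 a| <= M) ->
  `|S_dual tau b lam w a| <= \sum_(t < T) (M + M).
Proof.
move=> lM; apply: le_trans (ler_norm_sum _ _ _) _; apply: ler_sum => t _.
apply: le_trans (ler_normD _ _) _; rewrite !normrM.
have M0 : 0 <= M by apply: le_trans (lM t true).
by apply: lerD; rewrite -[leRHS]mulr1 ler_pM// ?indicator_sub_bound// distrC
  indicator_sub_bound.
Qed.

Lemma S_dualB (lam lam' : multiplier R T k) w a :
  S_dual tau b lam w a - S_dual tau b lam' w a =
  S_dual tau b (fun t s x a => lam t s x a - lam' t s x a) w a.
Proof. by rewrite /S_dual -sumrB; apply: eq_bigr => t _; ring. Qed.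

Lemma S_dualD (lam lam' : multiplier R T k) w a :
  S_dual tau b lam w a + S_dual tau b lam' w a =
  S_dual tau b (fun t s x a => lam t s x a + lam' t s x a) w a.
Proof. by rewrite /S_dual -big_split; apply: eq_bigr => t _ /=; ring. Qed.

Lemma S_dualZ c (lam : multiplier R T k) w a :
  c * S_dual tau b lam w a =
  S_dual tau b (fun t s x a => c * lam t s x a) w a.
Proof. by rewrite /S_dual mulr_sumr; apply: eq_bigr => t _ /=; ring. Qed.

Lemma S_dual0 (w : obsT) a : S_dual tau b (fun _ _ _ _ => 0) w a = 0.
Proof. by rewrite /S_dual big1// => t _; rewrite !mul0r addr0. Qed.

(** A multiplier with one nonzero component isolates one quantile restriction: a function of (x, a)
    times a step function of the single number a minus the residual. *)
Lemma S_dual_single (f : condT -> R) (t : 'I_T) (s : bool) (w : obsT) a :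
  S_dual tau b (fun t' s' x a => ((t' == t) && (s' == s))%:R * f (x, a)) w a =
  f (w.2, a) * (if s then tau - (0 < a - resid b w t)%R%:R
                else (0 <= a - resid b w t)%R%:R - tau).
Proof.
rewrite /S_dual (bigD1 t)//= big1 => [|t' /negbTE ->]; last first.
  by rewrite /= !mul0r addr0.
rewrite eqxx subr_ge0 subr_gt0 addr0.
by case: s; rewrite /= !(mul0r, mul1r, add0r, addr0).
Qed.

Lemma extension_resid_measurable (t : 'I_T) :
  measurable_fun setT
    (fun z : borel obsT * measurableTypeR R => resid b z.1 t).
Proof.
apply: (@measurableT_comp _ _ _ _ _ _ (fun w : borel obsT => resid b w t)) => //.
by apply: continuous_real_measurable; exact: resid_continuous.
Qed.

Lemma coupling_measurable (q : borel obsT * measurableTypeR R -> R) :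
  measurable_fun setT q ->
  measurable_fun setT (fun z : borel obsT * measurableTypeR R =>
    ((z.1.2, q z) : borel condT)).
Proof.
move=> mq; apply: measurable_fun_borel.
  by apply: separable_prod; [exact: separable_mx|exact: separable_real].
apply: ball_measurable_pair; last exact: ball_measurable_real.
apply: ball_measurable_mx => i j.
apply: (@measurableT_comp _ _ _ _ _ _ (fun w : borel obsT => w.2 i j)) => //.
apply: continuous_real_measurable => w.
by apply: (@continuous_comp _ _ _ snd (fun y : 'M[R]_(T, k) => y i j));
  [exact: cvg_snd|exact: coord_continuous].
Qed.

(** Continuity and bounds are global, not just on the support times K_b, which spares extension
    arguments; the restrictions still belong to [cont_multiplier]. *)
Definition test_multiplier (lam : multiplier R T k) : Prop :=
  (forall t s, continuous (fun p : condT => lam t s p.1 p.2)) /\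
  exists M, forall t s x a, 0 <= lam t s x a <= M.

(** Nonnegativity of the dual functional, phrased with measurable majorants of [S_dual] in place of
    its supremum over a. *)
Hypothesis dual_ge0 : forall lam h, test_multiplier lam ->
  bounded_measurable (h : borel obsT -> R) ->
  (forall w a, W w -> K_int Pobs b a -> S_dual tau b lam w a <= h w) ->
  0 <= \int[Pobs]_w h w.

Let lo := K_lo Pobs b.
Let hi := K_hi Pobs b.
Let Z : set (borel obsT * R) := [set z | W z.1 /\ lo <= z.2 <= hi].
Let C : set (borel obsT * R -> R) := [set s | exists2 lam, test_multiplier lam &
  s = fun z => S_dual tau b lam z.1 z.2].

Let C_functional : exists F : (borel obsT * R -> R) -> R,
  [/\ forall f g, bounded_on Z f -> bounded_on Z g -> F (f + g) = F f + F g,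
      forall a f, bounded_on Z f -> F (a *: f) = a * F f,
      forall f g, bounded_on Z f -> bounded_on Z g ->
        (forall z, Z z -> f z <= g z) -> F f <= F g,
      forall h, bounded_measurable h -> F (h \o fst) = \int[Pobs]_w h w &
      forall s, C s -> 0 <= F s].
Proof.
apply: marginal_functional.
- exists (fun _ _ _ _ => 0); last by apply/funext => z; rewrite S_dual0.
  split; first by move=> t s p; exact: cvg_cst.
  by exists 0 => *; rewrite lexx.
- move=> _ _ [l1 [c1 [M1 lM1]] ->] [l2 [c2 [M2 lM2]] ->].
  exists (fun t s x a => l1 t s x a + l2 t s x a); last first.
    by apply/funext => z; rewrite -S_dualD.
  split; first by move=> t s p; apply: continuousD; [exact: c1|exact: c2].
  exists (M1 + M2) => t s x a; have /andP[? ?] := lM1 t s x a.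
  by have /andP[? ?] := lM2 t s x a; rewrite addr_ge0 ?lerD.
- move=> c _ c0 [l1 [c1 [M1 lM1]] ->].
  exists (fun t s x a => c * l1 t s x a); last first.
    by apply/funext => z; rewrite -S_dualZ.
  split.
    by move=> t s p; apply: continuousM; [exact: cvg_cst|exact: c1].
  exists (c * M1) => t s x a; have /andP[? ?] := lM1 t s x a.
  by rewrite mulr_ge0 ?ler_wpM2l.
- move=> _ [l1 [c1 [M1 lM1]] ->]; exists (\sum_(t < T) (M1 + M1)) => z _.
  apply: S_dual_bound => t s; have /andP[? ?] := lM1 t s z.1.2 z.2.
  by rewrite ger0_norm.
- move=> _ h [l1 tl ->] bh Sh; apply: (dual_ge0 tl bh) => w a Ww Ka.
  by apply: (Sh (w, a)); split.
Qed.

(** The step function [xi] is not continuous, so the representation of [F] does not reach it. Its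
    continuous majorants [xin n] have ramps of slope [n] placed on the side that keeps them above
    [xi]; by monotonicity [F (phi n)] is nonnegative, hence so is its expectation at [q]. The limit
    in [n] is then an ordinary bounded convergence under the law of (w, q). *)
Lemma dual_coupling : exists q : borel obsT * measurableTypeR R -> R,
  measurable_fun setT q /\
  forall t s (f : condT -> R), continuous f -> (forall p, 0 <= f p <= 1) ->
    0 <= \int[uniform_extension Pobs]_z (f (z.1.2, q z) *
      (if s then tau - (0 < q z - resid b z.1 t)%R%:R
       else (0 <= q z - resid b z.1 t)%R%:R - tau)).
Proof.
have /andP[t0 t1] := tau01.
have [F [FD FZ Fle Fmarg FC]] := C_functional.
have [q [mq q_itv qF]] := marginal_representation K_lo_le_hi FD FZ Fle Fmarg.
exists q; split => // t s f cf f01.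
pose clip (x : R) := Num.max 0 (Num.min 1 x).
have clip01 x : 0 <= clip x <= 1.
  by rewrite /clip le_max lexx /= ge_max ler01 ge_min lexx.
have clip_cont : continuous clip.
  move=> x; apply: continuous_max; first exact: cvg_cst.
  by apply: continuous_min; [exact: cvg_cst|exact: cvg_id].
(* [xi] is upper semicontinuous, and [xin n] is continuous and decreases to it. *)
pose xi (x : R) := if s then tau - (0 < x)%R%:R else (0 <= x)%R%:R - tau.
pose xin n (x : R) := if s then tau - clip (n%:R * x)
                      else clip (1 + n%:R * x) - tau.
have xin_cont n : continuous (xin n).
  have cn (c : R) : continuous (fun x : R => clip (c + n%:R * x)).
    move=> x; apply: (@continuous_comp _ _ _ (fun x : R => c + n%:R * x) clip).
      apply: continuousD; first exact: cvg_cst.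
      by apply: continuousM; [exact: cvg_cst|exact: cvg_id].
    exact: clip_cont.
  have c0 : continuous (fun x : R => clip (n%:R * x)).
    rewrite (_ : (fun x : R => clip (n%:R * x)) =
                 (fun x : R => clip (0 + n%:R * x))); first exact: cn.
    by apply/funext => y; rewrite add0r.
  rewrite /xin; case: (s) => /= x; apply: cvgB; [exact: cvg_cst|exact: c0| |exact: cvg_cst].
  exact: cn.
have xin_bound n x : `|xin n x| <= 1.
  rewrite ler_norml /xin; case: (s).
    by have /andP[? ?] := clip01 (n%:R * x); apply/andP; split; lra.
  by have /andP[? ?] := clip01 (1 + n%:R * x); apply/andP; split; lra.
have xi_le n x : xi x <= xin n x.
  rewrite /xi /xin; case: (s); rewrite ?lerD2l ?lerD2r.
    rewrite lerN2; have /andP[c0 c1] := clip01 (n%:R * x).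
    case: ltP => // x0; rewrite /clip ge_max lexx /= ge_min.
    by rewrite (_ : n%:R * x <= 0) ?orbT// mulr_ge0_le0.
  have /andP[c0 c1] := clip01 (1 + n%:R * x).
  case: (leP 0 x) => // x0; rewrite /clip le_max le_min lexx /= lerDl.
  by rewrite mulr_ge0 ?orbT.
have xin_cvg x : xin n x @[n --> \oo] --> xi x.
  rewrite /xin /xi; case: (s).
    apply: cvgB; first exact: cvg_cst.
    case: ltP => x0; apply: cvg_near_cst.
      near=> n; rewrite /clip; have nx : 1 <= n%:R * x.
        rewrite -ler_pdivrMr// div1r; near: n; exact: nbhs_infty_ger.
      by rewrite min_l// max_r.
    apply: nearW => n; rewrite /clip max_l// ge_min.
    by rewrite (_ : n%:R * x <= 0) ?orbT// mulr_ge0_le0.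
  apply: cvgB; last exact: cvg_cst.
  case: leP => x0; apply: cvg_near_cst.
    apply: nearW => n; rewrite /clip min_l ?max_r// lerDl.
    by rewrite mulr_ge0.
  near=> n; rewrite /clip max_l// ge_min; apply/orP; right.
  rewrite -lerBrDl sub0r lerNr -mulrN -ler_pdivrMr ?oppr_gt0// div1r.
  by near: n; exact: nbhs_infty_ger.
pose phi n (z : borel obsT * R) :=
  f (z.1.2, z.2) * xin n (z.2 - resid b z.1 t).
have cphi n : continuous (phi n : obsT * R -> R).
  move=> z; apply: cvgM.
    apply: (@continuous_comp _ _ _ (fun z : obsT * R => (z.1.2, z.2)) f); last exact: cf.
    apply: continuous_pair => y; last exact: cvg_snd.
    by apply: (@continuous_comp _ _ _ fst (snd : obsT -> _)); [exact: cvg_fst|exact: cvg_snd].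
  apply: (@continuous_comp _ _ _ (fun z : obsT * R => z.2 - resid b z.1 t) (xin n)).
    apply: cvgB; first exact: cvg_snd.
    by apply: (@continuous_comp _ _ _ fst (fun w : obsT => resid b w t));
      [exact: cvg_fst|exact: resid_continuous].
  exact: xin_cont.
have phi_bound n z : `|phi n z| <= 1.
  have /andP[f0 f1] := f01 (z.1.2, z.2).
  by rewrite /phi normrM mulr_ile1 ?normr_ge0 ?xin_bound// ger0_norm.
have cphi1 n a : continuous (fun w : obsT => phi n (w, a)).
  move=> w; apply: (@continuous_comp _ _ _ (fun w : obsT => (w, a)) (phi n)).
    by apply: continuous_pair => y; [exact: cvg_id|exact: cvg_cst].
  exact: cphi.
have cphi2 n w : continuous (fun a : R => phi n (w, a)).
  move=> a; apply: (@continuous_comp _ _ _ (fun a : R => (w, a)) (phi n)).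
    by apply: continuous_pair => y; [exact: cvg_cst|exact: cvg_id].
  exact: cphi.
have Fphi n : F (phi n) =
    \int[uniform_extension Pobs]_z phi n (z.1, q z).
  apply: qF.
  - move=> a; split; first exact: continuous_real_measurable (cphi1 n a).
    by exists 1 => w; exact: phi_bound.
  - by exists 1 => z; exact: phi_bound.
  - exact: cphi2.
  - exact: (@compact_uniformly_continuous_r R obsT W lo hi (phi n) W_compact (cphi n)).
pose S z := S_dual tau b
  (fun t' s' x a => ((t' == t) && (s' == s))%:R * f (x, a)) z.1 z.2.
have SE z : S z = f (z.1.2, z.2) * xi (z.2 - resid b z.1 t).
  by rewrite /S S_dual_single.
have S_bound z : `|S z| <= 1.
  have /andP[f0 f1] := f01 (z.1.2, z.2).
  rewrite SE normrM mulr_ile1 ?normr_ge0//; first by rewrite ger0_norm.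
  rewrite /xi; case: (s); last exact: indicator_sub_bound.
  by rewrite distrC indicator_sub_bound.
have CS : C S.
  exists (fun t' s' x a => ((t' == t) && (s' == s))%:R * f (x, a)) => //.
  split.
    move=> t' s' p; apply: cvgM; first exact: cvg_cst.
    by rewrite (_ : (fun p : condT => f (p.1, p.2)) = f);
      [exact: cf|apply/funext; case].
  exists 1 => t' s' x a; have /andP[f0 f1] := f01 (x, a).
  by case: ((t' == t) && (s' == s)) => /=; apply/andP; split; lra.
have int_ge0 n : 0 <= \int[uniform_extension Pobs]_z phi n (z.1, q z).
  rewrite -Fphi; apply: le_trans (FC _ CS) _; apply: Fle.
  - by exists 1 => z _; exact: S_bound.
  - by exists 1 => z _; exact: phi_bound.
  - move=> z _; rewrite SE /phi ler_wpM2l ?xi_le//.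
    by case/andP: (f01 (z.1.2, z.2)).
have [|||_ int_cvg] := bounded_convergence (uniform_extension Pobs)
  (f_ := fun n z => phi n (z.1, q z))
  (f := fun z => f (z.1.2, q z) * xi (q z - resid b z.1 t)) (M := 1).
- move=> n; apply: measurable_funM.
    exact: (measurableT_comp (continuous_real_measurable cf)
      (coupling_measurable mq)).
  apply: (measurableT_comp (continuous_measurable_fun (xin_cont n))).
  by apply: measurable_funB => //; exact: extension_resid_measurable.
- by move=> n z; exact: phi_bound.
- by move=> z; apply: cvgM; [exact: cvg_cst|exact: xin_cvg].
have := @cvgP _ _ _ int_cvg => ic.
rewrite -(cvg_lim (@Rhausdorff R) int_cvg); apply: limr_ge => //.
exact: nearW.
Unshelve. all: by end_near. Qed.

End ModelFacts.

Lemma uniform_extension_fst d (Om : measurableType d) (R : realType)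
    (P : probability Om R) (C : set Om) : measurable C ->
  uniform_extension P [set z | C z.1] = P C.
Proof.
move=> mC; have -> : [set z | C z.1] = C `*` [set: measurableTypeR R].
  by apply/seteqP; split=> z //= -[].
rewrite /uniform_extension/= product_measure1E// -[RHS]mule1; congr (_ * _)%E.
exact: probability_setT.
Qed.

Lemma le_measure_of_integral d (Om : measurableType d) (R : realType)
    (P : probability Om R) (A E : set Om) (c : R) :
  measurable A -> measurable E ->
  (0 <= \int[P]_z (\1_A z * (\1_E z - c)) <-> (c%:E * P A <= P (E `&` A))%E) /\
  (0 <= \int[P]_z (\1_A z * (c - \1_E z)) <-> (P (E `&` A) <= c%:E * P A)%E).
Proof.
move=> mA mE.
have bA := bounded_measurable_indic R mA.
have bEA := bounded_measurable_indic R (measurableI _ _ mE mA).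
have eq1 z : \1_A z * (\1_E z - c) = \1_(E `&` A) z - c * \1_A z.
  by rewrite indicI /= mulrBr mulrC [_ * c]mulrC.
have int1 : \int[P]_z (\1_A z * (\1_E z - c)) =
    \int[P]_z (\1_(E `&` A) z) - c * \int[P]_z (\1_A z).
  under eq_Rintegral do rewrite eq1.
  by rewrite Rintegral_bmB ?Rintegral_bmZ//; exact: bounded_measurableZ.
have int2 : \int[P]_z (\1_A z * (c - \1_E z)) =
    - (\int[P]_z (\1_(E `&` A) z) - c * \int[P]_z (\1_A z)).
  rewrite -int1 -Rintegral_bmN; last first.
    apply: bounded_measurableM => //; apply: bounded_measurableB.
      exact: bounded_measurable_indic.
    exact: bounded_measurable_cst.
  by apply: eq_Rintegral => z _; rewrite -mulrN opprB.
rewrite int1 int2 -!Rintegral_bm_indic//; last exact: measurableI.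
by rewrite -EFinM !lee_fin subr_ge0 oppr_ge0 subr_le0.
Qed.

(** * The admissible law generated by a coupling *)

Section Law.
Context (R : realType) (T k : nat).
Local Notation obsT := ('cV[R]_T * 'M[R]_(T, k))%type.
Local Notation condT := ('M[R]_(T, k) * R)%type.
Local Notation fullT := ('cV[R]_T * 'M[R]_(T, k) * R * 'cV[R]_T)%type.

Lemma observed_continuous :
  continuous (fun z : fullT => (outcome z, regressor z) : obsT).
Proof.
apply: (@continuous_pair _ _ _ (@outcome R T k) (@regressor R T k)) => z.
  apply: (@continuous_comp _ _ _ (fun z : fullT => z.1.1) fst).
    by apply: (@continuous_comp _ _ _ fst fst); exact: cvg_fst.
  exact: cvg_fst.
apply: (@continuous_comp _ _ _ (fun z : fullT => z.1.1) snd).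
  by apply: (@continuous_comp _ _ _ fst fst); exact: cvg_fst.
exact: cvg_snd.
Qed.

Lemma effect_continuous : continuous (@effect R T k).
Proof.
move=> z; apply: (@continuous_comp _ _ _ fst snd); first exact: cvg_fst.
exact: cvg_snd.
Qed.

Lemma conditioning_continuous :
  continuous (fun z : fullT => (regressor z, effect z) : condT).
Proof.
apply: continuous_pair; last exact: effect_continuous.
move=> z; apply: (@continuous_comp _ _ _
  (fun z : fullT => (outcome z, regressor z) : obsT) snd).
  exact: observed_continuous.
exact: cvg_snd.
Qed.

Lemma disturbance_continuous t : continuous (fun z : fullT => disturbance z t 0).
Proof.
move=> z; apply: (@continuous_comp _ _ _ snd (fun u : 'cV[R]_T => u t 0)).
  exact: cvg_snd.
exact: coord_continuous.
Qed.

Lemma measurable_observed :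
  measurable_fun setT (@observed R T k : borel fullT -> borel obsT).
Proof. exact: (continuous_borel_measurable observed_continuous). Qed.

Lemma measurable_conditioning :
  measurable_fun setT (@conditioning R T k : borel fullT -> borel condT).
Proof. exact: (continuous_borel_measurable conditioning_continuous). Qed.

Lemma measurable_disturbance t :
  measurable_fun setT (fun z : borel fullT => disturbance z t 0).
Proof. exact: (continuous_real_measurable (disturbance_continuous (t := t))). Qed.

Lemma measurable_effect : measurable_fun setT (@effect R T k : borel fullT -> R).
Proof. exact: (continuous_real_measurable effect_continuous). Qed.

Lemma measurable_resid (b : 'cV[R]_k) t :
  measurable_fun setT (fun w : borel obsT => resid b w t).
Proof. by apply: continuous_real_measurable; exact: resid_continuous. Qed.

Lemma measurable_disturbance_le0 t :
  measurable ([set z | disturbance z t 0 <= 0] : set (borel fullT)).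
Proof.
rewrite -[X in measurable X]setTI.
have -> : [set z : fullT | disturbance z t 0 <= 0] =
    (fun z => disturbance z t 0 <= 0) @^-1` [set true].
  by apply/seteqP; split.
by apply: measurable_fun_ler => //; exact: measurable_disturbance.
Qed.

Lemma measurable_disturbance_lt0 t :
  measurable ([set z | disturbance z t 0 < 0] : set (borel fullT)).
Proof.
rewrite -[X in measurable X]setTI.
have -> : [set z : fullT | disturbance z t 0 < 0] =
    (fun z => disturbance z t 0 < 0) @^-1` [set true].
  by apply/seteqP; split.
by apply: measurable_fun_ltr => //; exact: measurable_disturbance.
Qed.

Context (Pobs : probability (borel obsT) R) (b : 'cV[R]_k) (tau : R).

(** With the disturbance defined as residual minus effect, U_t <= 0 is exactly [0 <= q - resid], and
    likewise for the strict signs. The tested inequalities extend from continuous functions of (x,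
    a) to Borel sets, and there they are the defining inequalities of the conditional bounds. *)
Lemma admissible_law_of_coupling (q : borel obsT * measurableTypeR R -> R) :
  measurable_fun setT q ->
  (forall t s (f : condT -> R), continuous f -> (forall p, 0 <= f p <= 1) ->
    0 <= \int[uniform_extension Pobs]_z (f (z.1.2, q z) *
      (if s then tau - (0 < q z - resid b z.1 t)%R%:R
       else (0 <= q z - resid b z.1 t)%R%:R - tau))) ->
  exists Ps : probability (borel fullT) R, admissible_law Pobs tau b Ps.
Proof.
move=> mq qP.
pose mu := uniform_extension Pobs.
pose Zm (z : borel obsT * measurableTypeR R) : borel fullT :=
  (z.1.1, z.1.2, q z, \col_t (resid b z.1 t - q z)).
have mresid t : measurable_fun setT
    (fun z : borel obsT * measurableTypeR R => resid b z.1 t).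
  exact: (measurableT_comp (measurable_resid b t)).
have mZm : measurable_fun setT Zm.
  apply: measurable_fun_borel.
    by repeat apply: separable_prod; exact: separable_mx || exact: separable_real.
  repeat apply: ball_measurable_pair.
  - apply: ball_measurable_mx => i j.
    apply: (@measurableT_comp _ _ _ _ _ _ (fun w : borel obsT => w.1 i j)) => //.
    apply: continuous_real_measurable => w; rewrite (ord1 j).
    exact: outcome_coord_continuous.
  - apply: ball_measurable_mx => i j.
    apply: (@measurableT_comp _ _ _ _ _ _ (fun w : borel obsT => w.2 i j)) => //.
    apply: continuous_real_measurable => w.
    by apply: (@continuous_comp _ _ _ snd (fun y : 'M[R]_(T, k) => y i j));
      [exact: cvg_snd|exact: coord_continuous].
  - exact: ball_measurable_real.
  - apply: ball_measurable_mx => i j.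
    rewrite (_ : (fun z => _) = (fun z => resid b z.1 i - q z)); last first.
      by apply/funext => z; rewrite mxE.
    exact: measurable_funB.
pose Zf : {mfun _ >-> borel fullT} := mfun_Sub (mem_set mZm).
have [Ps PsE] : exists Ps : probability (borel fullT) R,
    forall A, Ps A = mu (Zm @^-1` A) by exists (distribution mu Zf).
have ZmU z t : disturbance (Zm z) t 0 = resid b z.1 t - q z by rewrite /Zm /disturbance mxE.
have mV := coupling_measurable mq.
have mVC (C : set (borel condT)) : measurable C ->
    measurable ((fun z : borel obsT * measurableTypeR R =>
      ((z.1.2, q z) : borel condT)) @^-1` C).
  by move=> mC; rewrite -[X in measurable X]setTI; apply: (mV).
have mqr t : measurable_fun setT (fun z => q z - resid b z.1 t) by exact: measurable_funB.
exists Ps; split.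
- move=> C mC; rewrite /pushforward PsE -(uniform_extension_fst Pobs mC).
  by congr (mu _); apply/seteqP; split=> -[[y x] u].
(* [h] is the defect of the outcome equation. Along [Zm] it vanishes identically, so the exceptional
   set has empty preimage. *)
- move=> t; pose h (z : borel fullT) :=
    resid b (observed z) t - effect z - disturbance z t 0.
  have mh : measurable_fun setT h.
    apply: measurable_funB; last exact: measurable_disturbance.
    apply: measurable_funB; last exact: measurable_effect.
    exact: (measurableT_comp (measurable_resid b t) measurable_observed).
  exists (h @^-1` (~` [set 0])); split.
  + rewrite -[X in measurable X]setTI; apply: (mh) => //.
    by apply: measurableC; exact: measurable_set1.
  + rewrite PsE (_ : _ @^-1` _ = set0) ?measure0//.
    apply/seteqP; split=> z //=; apply.
    by rewrite /h ZmU /observed /effect /= /resid; ring.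
  + move=> z /= hz h0; apply: hz; move: h0.
    rewrite /h /resid /observed /= => /eqP.
    by rewrite -!addrA -!opprD subr_eq0 => /eqP ->.
- move=> t.
  have mE : measurable [set z | 0 <= q z - resid b z.1 t].
    rewrite -[X in measurable X]setTI.
    have -> : [set z | 0 <= q z - resid b z.1 t] =
        (fun z => 0 <= q z - resid b z.1 t) @^-1` [set true].
      by apply/seteqP; split.
    exact: measurable_fun_ler.
  have [g [gP g_ge _]] :=
    cond_prob_exists Ps (measurable_disturbance_le0 t) measurable_conditioning.
  exists g; [exact: gP|apply: g_ge => C mC; rewrite !PsE].
  have [[+ _] _] := le_measure_of_integral mu tau (mVC _ mC) mE.
  rewrite (_ : Zm @^-1` (_ `&` _) = [set z | 0 <= q z - resid b z.1 t] `&`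
      (fun z => ((z.1.2, q z) : borel condT)) @^-1` C); last first.
    by apply/funext => z; rewrite /setI /preimage /mkset ZmU subr_le0 subr_ge0.
  apply; have bxi : bounded_measurable
      (fun z => \1_[set z | 0 <= q z - resid b z.1 t] z - tau).
    apply: bounded_measurableB; first exact: bounded_measurable_indic.
    exact: bounded_measurable_cst.
  apply: (continuous_test_ge0 mV bxi _ mC) => f cf f01.
  rewrite [leRHS](_ : _ = \int[mu]_z (f (z.1.2, q z) *
    ((0 <= q z - resid b z.1 t)%R%:R - tau))); first exact: (qP t false).
  by apply: eq_Rintegral => z _; rewrite indicE mem_setE.
- move=> t.
  have mE : measurable [set z | 0 < q z - resid b z.1 t].
    rewrite -[X in measurable X]setTI.
    have -> : [set z | 0 < q z - resid b z.1 t] =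
        (fun z => 0 < q z - resid b z.1 t) @^-1` [set true].
      by apply/seteqP; split.
    exact: measurable_fun_ltr.
  have [g [gP _ g_le]] :=
    cond_prob_exists Ps (measurable_disturbance_lt0 t) measurable_conditioning.
  exists g; [exact: gP|apply: g_le => C mC; rewrite !PsE].
  have [_ [+ _]] := le_measure_of_integral mu tau (mVC _ mC) mE.
  rewrite (_ : Zm @^-1` (_ `&` _) = [set z | 0 < q z - resid b z.1 t] `&`
      (fun z => ((z.1.2, q z) : borel condT)) @^-1` C); last first.
    by apply/funext => z; rewrite /setI /preimage /mkset ZmU subr_lt0 subr_gt0.
  apply; have bxi : bounded_measurable
      (fun z => tau - \1_[set z | 0 < q z - resid b z.1 t] z).
    apply: bounded_measurableB; last exact: bounded_measurable_indic.
    exact: bounded_measurable_cst.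
  apply: (continuous_test_ge0 mV bxi _ mC) => f cf f01.
  rewrite [leRHS](_ : _ = \int[mu]_z (f (z.1.2, q z) *
    (tau - (0 < q z - resid b z.1 t)%R%:R))); first exact: (qP t true).
  by apply: eq_Rintegral => z _; rewrite indicE mem_setE.
Qed.

End Law.

(** * From an admissible law to dual nonnegativity *)

Section AlmostEverywhere.
Context d (T : measurableType d) (R : realType) (P : probability T R).

Lemma ae_imply (A B : T -> Prop) : {ae P, forall x, A x} ->
  (forall x, A x -> B x) -> {ae P, forall x, B x}.
Proof. by move=> hA AB; apply: filterS hA => x; exact: AB. Qed.

Lemma ae_imply2 (A B C : T -> Prop) : {ae P, forall x, A x} ->
  {ae P, forall x, B x} -> (forall x, A x -> B x -> C x) ->
  {ae P, forall x, C x}.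
Proof. by move=> hA hB ABC; apply: filterS2 hA hB => x; exact: ABC. Qed.

Lemma ae_forall_fin (I : finType) (A : I -> T -> Prop) :
  (forall i, {ae P, forall x, A i x}) -> {ae P, forall x, forall i, A i x}.
Proof. by move=> hA; exact: filter_forall. Qed.

Lemma le_integral_ae (D : set T) (f g : T -> R) : measurable D ->
  P.-integrable D (EFin \o f) -> P.-integrable D (EFin \o g) ->
  {ae P, forall x, f x <= g x} ->
  (\int[P]_(x in D) (f x)%:E <= \int[P]_(x in D) (g x)%:E)%E.
Proof.
move=> mD fi gi fg.
have mfg : measurable_fun D (fun x => g x - f x).
  by apply: measurable_funB; apply/measurable_EFinP; [exact: measurable_int gi|exact: measurable_int fi].
rewrite -sube_ge0; last by apply/orP; left; exact: integrable_fin_num.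
have -> : (\int[P]_(x in D) (g x)%:E - \int[P]_(x in D) (f x)%:E =
    \int[P]_(x in D) (g x - f x)%:E)%E.
  by rewrite -integralB_EFin.
(* The difference is replaced by its absolute value, which equals it almost everywhere and is
   nonnegative at every point. *)
rewrite (@ae_eq_integral _ _ _ P D (fun x => (`|g x - f x|)%:E)) //.
- by apply: integral_ge0 => x _; rewrite lee_fin.
- exact/measurable_EFinP.
- by apply/measurable_EFinP; exact: measurableT_comp.
- by apply: filterS fg => x fgx _; rewrite ger0_norm// subr_ge0.
Qed.

Lemma le_Rintegral_bm_ae (h1 h2 : T -> R) :
  bounded_measurable h1 -> bounded_measurable h2 ->
  {ae P, forall x, h1 x <= h2 x} -> \int[P]_x h1 x <= \int[P]_x h2 x.
Proof.
move=> b1 b2 h12; rewrite -lee_fin !EFin_Rintegral//.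
by apply: le_integral_ae => //; exact: bounded_measurable_integrable.
Qed.

Lemma le_measure_ae (A B : set T) : measurable A -> measurable B ->
  {ae P, forall x, A x -> B x} -> (P A <= P B)%E.
Proof.
move=> mA mB AB; rewrite -!Rintegral_bm_indic// lee_fin.
apply: le_Rintegral_bm_ae; [exact: bounded_measurable_indic..|].
apply: filterS AB => x AB; rewrite !indicE.
have [/set_mem/AB/mem_set ->//|_] := boolP (x \in A).
by case: (_ \in _); rewrite ?lexx ?ler01.
Qed.

(** Simple functions approximating [k] uniformly have nonnegative coefficients, so the inequality
    for sets sums up; the error is at most the mesh times the bound of [psi]. *)
Lemma nonneg_test_ge0 d' (S : measurableType d') (V : T -> S) (psi : T -> R)
    (k : S -> R) (M : R) :
  measurable_fun setT V -> bounded_measurable psi ->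
  (forall C, measurable C -> 0 <= \int[P]_z (\1_C (V z) * psi z)) ->
  measurable_fun setT k -> (forall x, 0 <= k x <= M) ->
  0 <= \int[P]_z (k (V z) * psi z).
Proof.
move=> mV bpsi test mk kM; have [_ [K0 psiK0]] := bpsi.
pose K := Num.max K0 0 + 1.
have K_gt0 : 0 < K by rewrite ltr_wpDl// le_max lexx orbT.
have psiK z : `|psi z| <= K.
  by rewrite /K (le_trans (psiK0 z))// ler_wpDr// le_max lexx.
apply/ler_addgt0Pl => eps e0; rewrite addrC -lerBlDr sub0r.
have d0 : 0 < eps / K by rewrite divr_gt0.
(* The base level is 0, the lower bound of [k]: no constant term of unknown sign remains. *)
have [n [A [mA kA]]] := measurable_simple_approx mk kM d0.
have b1 i : bounded_measurable (fun z => \1_(A i) (V z) : R).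
  split; first by apply: measurableT_comp => //; exact: measurable_indic.
  by exists 1 => z; rewrite indicE; case: (_ \in _); rewrite ?normr1 ?normr0.
have bk : bounded_measurable (fun z => k (V z)).
  split; first exact: measurableT_comp.
  by exists M => z; case/andP: (kM (V z)) => ? ?; rewrite ger0_norm.
pose s z : R := eps / K * \sum_(i < n) \1_(A i) (V z) * psi z.
have bs1 : bounded_measurable (fun z => \sum_(i < n) \1_(A i) (V z) * psi z).
  by apply: bounded_measurable_sum => i; exact: bounded_measurableM.
have bs : bounded_measurable s by exact: bounded_measurableZ.
have s_ge0 : 0 <= \int[P]_z s z.
  rewrite Rintegral_bmZ// mulr_ge0 ?(ltW d0)// Rintegral_bm_sum.
    by apply: sumr_ge0 => i _; exact: test.
  by move=> i; exact: bounded_measurableM.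
have -> : - eps = 0 - eps by rewrite sub0r.
apply: (@le_trans _ _ (\int[P]_z (s z - eps))).
  by rewrite Rintegral_bmB ?Rintegral_prob_cst ?lerB//; exact: bounded_measurable_cst.
apply: le_Rintegral_bm => [||z].
- by apply: bounded_measurableB => //; exact: bounded_measurable_cst.
- exact: bounded_measurableM.
- rewrite lerBlDr -lerBlDl /s -mulr_suml mulrA -mulrBl.
  rewrite (le_trans (ler_norm _))// normrM -[leRHS](divfK (lt0r_neq0 K_gt0)).
  apply: ler_pM => //; rewrite distrC; have := kA (V z); by rewrite add0r.
Qed.

End AlmostEverywhere.

Lemma cond_prob_ge d d' (Om : measurableType d) (S : measurableType d')
    (R : realType) (P : probability Om R) (E : set Om) (V : Om -> S)
    (g : S -> R) (tau : R) (C : set S) :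
  measurable_fun setT V -> cond_prob_version P E V g -> measurable C ->
  ({ae P, forall z, tau <= g (V z)} ->
     (tau%:E * P (V @^-1` C) <= P (E `&` V @^-1` C))%E) /\
  ({ae P, forall z, g (V z) <= tau} ->
     (P (E `&` V @^-1` C) <= tau%:E * P (V @^-1` C))%E).
Proof.
move=> mV [mg gi gE] mC.
have mVC : measurable (V @^-1` C).
  by rewrite -[X in measurable X]setTI; exact: mV.
have ci : P.-integrable (V @^-1` C) (EFin \o (fun=> tau)).
  apply: (integrableS measurableT) => //.
  exact/bounded_measurable_integrable/bounded_measurable_cst.
have giC : P.-integrable (V @^-1` C) (EFin \o (g \o V)).
  exact: (integrableS measurableT).
have cE : (\int[P]_(z in V @^-1` C) (tau%:E : \bar R) = tau%:E * P (V @^-1` C))%E.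
  by rewrite integral_cst.
by rewrite -gE// -cE; split=> ?; exact: le_integral_ae.
Qed.

Lemma indic_pred (T : Type) (R : realType) (p : pred T) x :
  \1_[set y | p y] x = (p x)%:R :> R.
Proof. by rewrite indicE mem_setE. Qed.

Section Clip.
Context (R : realType) (lo hi : R).
Hypothesis lohi : lo <= hi.

Definition clip (a : R) : R := Num.max lo (Num.min hi a).

Lemma clip_itv a : lo <= clip a <= hi.
Proof. by rewrite /clip le_max lexx ge_max lohi /= ge_min lexx. Qed.

Lemma clip_id a : lo <= a <= hi -> clip a = a.
Proof. by move=> /andP[la ah]; rewrite /clip min_r// max_r. Qed.

Lemma clip_continuous : continuous clip.
Proof.
move=> x; apply: continuous_max; first exact: cvg_cst.
by apply: continuous_min; [exact: cvg_cst|exact: cvg_id].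
Qed.

End Clip.

Lemma measurable_fun_gt d (T : measurableType d) (R : realType) (f : T -> R) :
  (forall c, measurable [set x | c < f x]) -> measurable_fun setT f.
Proof.
move=> mf; apply: (measurability _ (RGenOInfty.measurableE R)) => //.
move=> _ [_ [c ->] <-]; rewrite setTI.
rewrite (_ : _ @^-1` _ = [set x | c < f x])//.
by apply/seteqP; split=> x /=; rewrite in_itv/= andbT.
Qed.

Lemma measurable_gt_set d (T : measurableType d) (R : realType) (f : T -> R) c :
  measurable_fun setT f -> measurable [set x | c < f x].
Proof.
move=> mf; rewrite -[X in measurable X]setTI.
have -> : [set x | c < f x] = (fun x => c < f x) @^-1` [set true].
  by apply/seteqP; split.
by apply: measurable_fun_ltr.
Qed.

(** * The dual value of a bounded multiplier continuous in a *)

Section RegularMultiplier.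
Context (R : realType) (T k : nat).
Local Notation obsT := ('cV[R]_T * 'M[R]_(T, k))%type.
Local Notation condT := ('M[R]_(T, k) * R)%type.
Local Notation fullT := ('cV[R]_T * 'M[R]_(T, k) * R * 'cV[R]_T)%type.
Context (Pobs : probability (borel obsT) R) (b : 'cV[R]_k) (tau : R).
Local Notation W := (obs_support Pobs).
Hypothesis W_compact : compact W.
Hypothesis T_ge1 : (1 <= T)%N.
Hypothesis tau01 : 0 < tau < 1.
Let lo := K_lo Pobs b.
Let hi := K_hi Pobs b.
Let lohi : lo <= hi := K_lo_le_hi b W_compact T_ge1.

Context (lam : multiplier R T k) (M : R).
Hypothesis lam_meas : forall t s,
  measurable_fun setT (fun p : borel condT => lam t s p.1 p.2).
Hypothesis lam_cont : forall t s x, continuous (lam t s x).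
Hypothesis lam_itv : forall t s x a, 0 <= lam t s x a <= M.

Definition value (w : obsT) : R :=
  sup [set S_dual tau b lam w a | a in K_int Pobs b].

Let bound : R := \sum_(t < T) (M + M).

Let S_bound w a : `|S_dual tau b lam w a| <= bound.
Proof.
apply: S_dual_bound => // t s; have /andP[l0 lM] := lam_itv t s w.2 a.
by rewrite ger0_norm.
Qed.

Let K_nonempty : K_int Pobs b lo.
Proof. by rewrite /K_int/= lexx. Qed.

Lemma le_value w a : K_int Pobs b a -> S_dual tau b lam w a <= value w.
Proof.
move=> Ka; apply: sup_ubound; last by exists a.
by exists bound => _ [c _ <-]; exact: le_trans (ler_norm _) (S_bound w c).
Qed.

Lemma value_le w c : (forall a, K_int Pobs b a -> S_dual tau b lam w a <= c) ->
  value w <= c.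
Proof.
move=> Sc; apply: sup_le_ub; first by exists (S_dual tau b lam w lo), lo.
by move=> _ [a Ka <-]; exact: Sc.
Qed.

Lemma measurable_S_dual (alpha : obsT -> R) :
  measurable_fun setT (alpha : borel obsT -> R) ->
  measurable_fun setT (fun w : borel obsT => S_dual tau b lam w (alpha w)).
Proof.
move=> malpha.
have mpair : measurable_fun setT
    (fun w : borel obsT => ((w.2, alpha w) : borel condT)).
  apply: measurable_fun_borel.
    by apply: separable_prod; [exact: separable_mx|exact: separable_real].
  apply: ball_measurable_pair; last exact: ball_measurable_real.
  apply: ball_measurable_mx => i j.
  apply: continuous_real_measurable => w.
  by apply: (@continuous_comp _ _ _ snd (fun y : 'M[R]_(T, k) => y i j));
    [exact: cvg_snd|exact: coord_continuous].
have mlam t s : measurable_fun setT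
    (fun w : borel obsT => lam t s w.2 (alpha w)).
  exact: (measurableT_comp (lam_meas t s) mpair).
have mres t := measurable_resid b t.
rewrite /S_dual; apply: measurable_sum => t.
apply: measurable_funD; apply: measurable_funM; try exact: mlam.
  apply: measurable_funB; last exact: measurable_cst.
  rewrite (_ : (fun w : borel obsT => _) = \1_[set w | resid b w t <= alpha w]); last first.
    by apply/funext => w; rewrite indicE mem_setE.
  apply: measurable_indic; rewrite -[X in measurable X]setTI.
  have -> : [set w | resid b w t <= alpha w] =
      (fun w => resid b w t <= alpha w) @^-1` [set true] by apply/seteqP; split.
  exact: measurable_fun_ler.
apply: measurable_funB; first exact: measurable_cst.
rewrite (_ : (fun w : borel obsT => _) = \1_[set w | resid b w t < alpha w]); last first.
  by apply/funext => w; rewrite indicE mem_setE.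
apply: measurable_indic; rewrite -[X in measurable X]setTI.
have -> : [set w | resid b w t < alpha w] =
    (fun w => resid b w t < alpha w) @^-1` [set true] by apply/seteqP; split.
exact: measurable_fun_ltr.
Qed.

(** Away from the residuals the indicators are locally constant. Clipping keeps the approximating
    points inside K_b even when [a] is an endpoint or K_b is a single point. *)
Lemma S_dual_clip_cvg w a : K_int Pobs b a -> (forall t, resid b w t != a) ->
  S_dual tau b lam w (clip lo hi x) @[x --> a] --> S_dual tau b lam w a.
Proof.
move=> Ka ra; have clipa : clip lo hi a = a by exact: clip_id.
have cclip : clip lo hi x @[x --> a] --> a.
  by rewrite -{2}clipa; exact: clip_continuous.
have clam t s : lam t s w.2 (clip lo hi x) @[x --> a] --> lam t s w.2 a.
  exact: (cvg_comp _ _ cclip (@lam_cont t s w.2 a)).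
have near_ind t : \forall x \near a,
    ((resid b w t <= clip lo hi x) = (resid b w t <= a)) /\
    ((resid b w t < clip lo hi x) = (resid b w t < a)).
  have := ra t; rewrite neq_lt => /orP[r_lt|r_gt].
    apply: filterS (cvgr_gt a cclip _ r_lt) => x rx.
    by rewrite rx (ltW rx) r_lt (ltW r_lt).
  apply: filterS (cvgr_lt a cclip _ r_gt) => x rx.
  by rewrite !leNgt rx r_gt /= !ltNge (ltW rx) (ltW r_gt).
rewrite /S_dual.
apply: (@cvg_big _ _ +%R 0 xpredT (@add_continuous R^o) _ _ _
  (fun t x => lam t false w.2 (clip lo hi x) * ((resid b w t <= clip lo hi x)%R%:R - tau) +
     lam t true w.2 (clip lo hi x) * (tau - (resid b w t < clip lo hi x)%R%:R))) => t _.
apply: cvgD; apply: cvgM; try exact: clam; apply: cvgB; try exact: cvg_cst.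
  by apply: cvg_near_cst; apply: filterS (near_ind t) => x [-> _].
by apply: cvg_near_cst; apply: filterS (near_ind t) => x [_ ->].
Qed.

(* [S_dual] is continuous in [a] except at the [T] residuals, so the supremum is
   over the rationals of K_b and these residuals. *)
Lemma value_bounded_measurable :
  bounded_measurable (value : borel obsT -> R).
Proof.
split; last first.
  exists bound => w; rewrite ler_norml; apply/andP; split.
    apply: le_trans (le_value w K_nonempty); apply: lerNnormlW; exact: S_bound.
  by apply: value_le => a _; exact: le_trans (ler_norm _) (S_bound w a).
apply: measurable_fun_gt => c.
rewrite (_ : [set w : borel obsT | c < value w] =
  (\bigcup_(q in [set: rat]) [set w : borel obsT | c < S_dual tau b lam w (clip lo hi (ratr q))]) `|`
  \bigcup_(t in [set: 'I_T]) [set w : borel obsT | c < S_dual tau b lam w (clip lo hi (resid b w t))]).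
  apply: measurableU.
    apply: bigcupT_measurable_rat => q; apply: measurable_gt_set.
    by apply: measurable_S_dual; exact: measurable_cst.
  apply: fin_bigcup_measurable; first exact: finite_finset.
  move=> t _; apply: measurable_gt_set; apply: measurable_S_dual.
  apply: (measurableT_comp (continuous_measurable_fun (@clip_continuous R lo hi))).
  exact: measurable_resid.
apply/seteqP; split=> w /=; last first.
  by move=> [[q _]|[t _]] /lt_le_trans; apply; apply: le_value; exact: clip_itv.
move=> /sup_gt[|_ [a Ka <-] cS]; first by exists (S_dual tau b lam w lo), lo.
have [[t ra]|ra] := pselect (exists t, resid b w t = a).
  by right; exists t => //=; rewrite ra clip_id.
left; have ra' t : resid b w t != a by apply/eqP => rt; apply: ra; exists t.
have near_a : \forall x \near a, c < S_dual tau b lam w (clip lo hi x).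
  exact: cvgr_gt (S_dual_clip_cvg Ka ra') _ cS.
move/nbhs_ballP : near_a => [e /= e0 ae].
have /rat_in_itvoo[q] : a - e < a + e by lra.
rewrite in_itv/= => /andP[q1 q2]; exists q => //=.
by apply: ae; rewrite -ball_normE/= ltr_distlC q1.
Qed.

Lemma Psi_value : Psi Pobs tau b lam = (\int[Pobs]_w value w)%:E.
Proof.
have bv := value_bounded_measurable.
have mW : measurable (W : set (borel obsT)) by exact: law_support_measurable.
rewrite EFin_Rintegral// /Psi integral_mkcond; apply: ae_eq_integral => //.
- apply/(measurable_restrictT _ mW); apply: measurable_funTS.
  by apply/measurable_EFinP; exact: bv.1.
- by apply/measurable_EFinP; exact: bv.1.
- have WW := law_support_ae (@separable_obs R T k) Pobs.
  by apply: (ae_imply WW) => w Ww _; rewrite patchE mem_set.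
Qed.

Lemma admissible_value_ge0 (Ps : probability (borel fullT) R) :
  admissible_law Pobs tau b Ps -> 0 <= \int[Pobs]_w value w.
Proof.
move=> [marg model cond_le cond_lt].
have /andP[tau0 tau1] := tau01.
have mcond := @measurable_conditioning R T k.
have mobs := @measurable_observed R T k.
have bv := value_bounded_measurable.
have obs_ae : {ae Ps, forall z, W (observed z)}.
  exists (@observed R T k @^-1` (~` W)); split => //.
    rewrite -[X in measurable X]setTI; apply: (mobs) => //; apply: measurableC.
    exact: law_support_measurable.
  have := marg (~` W); rewrite /pushforward => ->.
    exact: law_support_full (@separable_obs R T k) Pobs.
  by apply: measurableC; exact: law_support_measurable.
have le_ineq t (C : set (borel condT)) : measurable C ->
    (tau%:E * Ps (@conditioning R T k @^-1` C) <=
     Ps ([set z | (disturbance z t 0 <= 0)%R] `&` @conditioning R T k @^-1` C))%E.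
  move=> mC; have [g gP g_ge] := cond_le t.
  by have [+ _] := cond_prob_ge tau mcond gP mC; exact.
have lt_ineq t (C : set (borel condT)) : measurable C ->
    (Ps ([set z | (disturbance z t 0 < 0)%R] `&` @conditioning R T k @^-1` C) <=
     tau%:E * Ps (@conditioning R T k @^-1` C))%E.
  move=> mC; have [g gP g_le] := cond_lt t.
  by have [_ +] := cond_prob_ge tau mcond gP mC; exact.
have mVC (C : set (borel condT)) : measurable C ->
    measurable (@conditioning R T k @^-1` C : set (borel fullT)).
  by move=> mC; rewrite -[X in measurable X]setTI; exact: mcond.
have mEle t := @measurable_disturbance_le0 R T k t.
have mElt t := @measurable_disturbance_lt0 R T k t.
pose t0 : 'I_T := Ordinal T_ge1.
(* With p the probability of A > [hi], the strict restriction on that event gives p <= tau p, and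
   tau < 1 forces p = 0. *)
have hi_ae : {ae Ps, forall z, effect z <= hi}.
  pose C : set (borel condT) := [set p | hi < p.2].
  have mC : measurable C.
    apply: measurable_open; rewrite /C -[X in open X]/(snd @^-1` [set a | hi < a]).
    by apply: open_comp => [x _|]; [exact: cvg_snd|exact: open_gt].
  have PC : (Ps (@conditioning R T k @^-1` C) <=
      Ps ([set z | (disturbance z t0 0 < 0)%R] `&` @conditioning R T k @^-1` C))%E.
    apply: le_measure_ae; [exact: mVC|by apply: measurableI; [exact: mElt|exact: mVC]|].
    apply: (ae_imply2 obs_ae (model t0)) => z Wz mz Cz.
    split=> //; have /andP[_ rhi] := resid_in_K b W_compact t0 Wz.
    move: rhi Cz; rewrite /resid /observed /C /conditioning /= mz -/hi; lra.
  have := le_trans PC (lt_ineq t0 C mC).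
  have Pfin : Ps (@conditioning R T k @^-1` C) \is a fin_num.
    by apply: fin_num_measure; exact: mVC.
  move=> le_tau; exists (@conditioning R T k @^-1` C); split; first exact: mVC.
    apply/eqP; rewrite eq_le measure_ge0 andbT.
    move: le_tau Pfin (measure_ge0 Ps (@conditioning R T k @^-1` C)).
    case: (Ps _) => // r; rewrite -EFinM !lee_fin => ? _ ?; nra.
  by move=> z /=; rewrite /C /= ltNge => /negP.
(* Now U_t <= 0 almost never happens on the event A < [lo], so tau times its probability is at most
   0, and tau > 0. *)
have lo_ae : {ae Ps, forall z, lo <= effect z}.
  pose C : set (borel condT) := [set p | p.2 < lo].
  have mC : measurable C.
    apply: measurable_open; rewrite /C -[X in open X]/(snd @^-1` [set a | a < lo]).
    by apply: open_comp => [x _|]; [exact: cvg_snd|exact: open_lt].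
  have PC : (Ps ([set z | (disturbance z t0 0 <= 0)%R] `&` @conditioning R T k @^-1` C)
      <= Ps set0)%E.
    apply: le_measure_ae => //; first by apply: measurableI; [exact: mEle|exact: mVC].
    apply: (ae_imply2 obs_ae (model t0)) => z Wz mz [Ez Cz].
    have /andP[rlo _] := resid_in_K b W_compact t0 Wz.
    exfalso; move: Ez rlo Cz; rewrite /resid /observed /C /conditioning /= mz -/lo; lra.
  have := le_trans (le_ineq t0 C mC) PC; rewrite measure0.
  have Pfin : Ps (@conditioning R T k @^-1` C) \is a fin_num.
    by apply: fin_num_measure; exact: mVC.
  move=> le_tau; exists (@conditioning R T k @^-1` C); split; first exact: mVC.
    apply/eqP; rewrite eq_le measure_ge0 andbT.
    move: le_tau Pfin (measure_ge0 Ps (@conditioning R T k @^-1` C)).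
    case: (Ps _) => // r; rewrite -EFinM !lee_fin => ? _ ?; nra.
  by move=> z /=; rewrite /C /= ltNge => /negP.
pose ile t (z : borel fullT) : R := \1_[set z | disturbance z t 0 <= 0] z - tau.
pose ilt t (z : borel fullT) : R := tau - \1_[set z | disturbance z t 0 < 0] z.
have bile t : bounded_measurable (ile t).
  apply: bounded_measurableB; last exact: bounded_measurable_cst.
  by apply: bounded_measurable_indic; exact: mEle.
have bilt t : bounded_measurable (ilt t).
  apply: bounded_measurableB; first exact: bounded_measurable_cst.
  by apply: bounded_measurable_indic; exact: mElt.
pose l t s (z : borel fullT) := lam t s (conditioning z).1 (conditioning z).2.
have bl t s : bounded_measurable (l t s).
  split; first exact: (measurableT_comp (lam_meas t s) mcond).
  exists M => z; rewrite /l.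
  by have /andP[? ?] := lam_itv t s (conditioning z).1 (conditioning z).2; rewrite ger0_norm.
(* The score at (W, A) with its indicators written through the signs of U_t. It equals [S_dual] only
   almost surely, but in this form the conditional restrictions apply term by term. *)
pose H (z : borel fullT) : R :=
  \sum_(t < T) (l t false z * ile t z + l t true z * ilt t z).
have bterm t : bounded_measurable (fun z => l t false z * ile t z + l t true z * ilt t z).
  by apply: bounded_measurableD; exact: bounded_measurableM.
have H_ge0 : 0 <= \int[Ps]_z H z.
  rewrite Rintegral_bm_sum//; apply: sumr_ge0 => t _.
  rewrite Rintegral_bmD; [|exact: bounded_measurableM..].
  apply: addr_ge0.
    apply: (@nonneg_test_ge0 _ _ _ Ps _ (borel condT) (@conditioning R T k)
      (ile t) (fun p => lam t false p.1 p.2) M) => // C mC.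
    have [[_ h] _] := le_measure_of_integral Ps tau (mVC C mC) (mEle t).
    exact: h (le_ineq t C mC).
  apply: (@nonneg_test_ge0 _ _ _ Ps _ (borel condT) (@conditioning R T k)
    (ilt t) (fun p => lam t true p.1 p.2) M) => // C mC.
  have [_ [_ h]] := le_measure_of_integral Ps tau (mVC C mC) (mElt t).
  exact: h (lt_ineq t C mC).
have H_le : {ae Ps, forall z, H z <= value (@observed R T k z)}.
  have K_ae := ae_imply2 lo_ae hi_ae (fun z lz hz => conj lz hz).
  apply: (ae_imply2 K_ae (ae_forall_fin model)) => z [loz hiz] mz.
  have -> : H z = S_dual tau b lam (observed z) (effect z).
    apply: eq_bigr => t _; rewrite /l /ile /ilt.
    have dE : disturbance z t 0 = resid b (observed z) t - effect z.
      by rewrite /resid /observed /= mz; ring.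
    by rewrite (indic_pred R (fun z : fullT => disturbance z t 0 <= 0))
      (indic_pred R (fun z : fullT => disturbance z t 0 < 0)) dE subr_le0 subr_lt0.
  by apply: le_value; rewrite /K_int/= -/lo -/hi loz hiz.
have bvo : bounded_measurable (fun z : borel fullT => value (observed z)).
  split; first exact: (measurableT_comp bv.1 mobs).
  by case: bv => _ [N vN]; exists N => z; exact: vN.
have bH : bounded_measurable H by exact: bounded_measurable_sum.
apply: (le_trans (le_trans H_ge0 (le_Rintegral_bm_ae bH bvo H_le))).
(* The marginal condition is known on sets; it is carried over to the integral of [value]. *)
pose J1 (h : borel obsT -> R) := \int[Ps]_z h (observed z).
pose J2 (h : borel obsT -> R) := \int[Pobs]_w h w.
have bobs (h : borel obsT -> R) : bounded_measurable h ->
    bounded_measurable (fun z : borel fullT => h (observed z)).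
  move=> [mh [N hN]]; split; first exact: (measurableT_comp mh mobs).
  by exists N => z; exact: hN.
suff : J1 value = J2 value by rewrite /J1 /J2 => ->.
apply: bounded_measurable_functional_ext bv.
  move=> J [|] ->; rewrite /J1 /J2; split.
  - by move=> h1 h2 b1 b2; rewrite -Rintegral_bmD//; exact: bobs.
  - by move=> c h1 b1; rewrite -Rintegral_bmZ//; exact: bobs.
  - by move=> h1 h2 b1 b2 le12; apply: le_Rintegral_bm => //; exact: bobs.
  - by move=> h1 h2 b1 b2; rewrite -Rintegral_bmD.
  - by move=> c h1 b1; rewrite -Rintegral_bmZ.
  - by move=> h1 h2 b1 b2 le12; exact: le_Rintegral_bm.
move=> A mA; rewrite /J1 /J2; apply: EFin_inj.
have moA : measurable (@observed R T k @^-1` A : set (borel fullT)).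
  by rewrite -[X in measurable X]setTI; exact: mobs.
have -> : \int[Ps]_z (\1_A (observed z)) = \int[Ps]_z (\1_(@observed R T k @^-1` A) z).
  apply: eq_Rintegral => z _; rewrite !indicE.
  have -> // : (observed z \in A) = (z \in @observed R T k @^-1` A).
  by apply/idP/idP; rewrite !inE.
by rewrite !Rintegral_bm_indic//; exact: marg.
Qed.

End RegularMultiplier.

(** * Piecewise-linear multipliers *)

Lemma continuous_sum (R : realType) (E : topologicalType) (I : Type) (r : seq I)
    (f : I -> E -> R) :
  (forall i, continuous (f i)) -> continuous (fun x => \sum_(i <- r) f i x).
Proof.
move=> cf x; apply: (@cvg_big _ _ +%R 0 xpredT (@add_continuous R^o) _ _ _ f) => i _.
exact: cf.
Qed.

Section MultiplierCone.
Context (R : realType) (T k : nat).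
Local Notation obsT := ('cV[R]_T * 'M[R]_(T, k))%type.
Local Notation condT := ('M[R]_(T, k) * R)%type.

Lemma hat_continuous L (kap : nat -> R) l : continuous (hat L kap l).
Proof.
have affine (c d : R) : continuous (fun a : R => (a - c) / d).
  move=> a; apply: cvgM; last exact: cvg_cst.
  by apply: cvgB; [exact: cvg_id|exact: cvg_cst].
have affine' (c d : R) : continuous (fun a : R => (c - a) / d).
  move=> a; apply: cvgM; last exact: cvg_cst.
  by apply: cvgB; [exact: cvg_cst|exact: cvg_id].
pose up (a : R) := if l is l'.+1 then (a - kap l') / (kap l - kap l') else 1.
pose down (a : R) := if (l < L)%N then (kap l.+1 - a) / (kap l.+1 - kap l) else 1.
have cup : continuous up.
  by rewrite /up; case: (l) => [|l'] a; [exact: cvg_cst|exact: affine].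
have cdown : continuous down.
  by rewrite /down; case: (l < L)%N => a; [exact: affine'|exact: cvg_cst].
move=> a; apply: (@continuous_max R R (fun=> 0) (up \min down)).
  exact: cvg_cst.
by apply: (@continuous_min R R up down); [exact: cup|exact: cdown].
Qed.

Lemma hat_ge0 L (kap : nat -> R) l a : 0 <= hat L kap l a.
Proof. by rewrite /hat le_max lexx. Qed.

Context (Pobs : probability (borel obsT) R) (b : 'cV[R]_k) (tau : R).
Local Notation W := (obs_support Pobs).

(** [Psi] reads a multiplier only at regressors of support points and at a in K_b, so a member of
    the cone, unspecified elsewhere, may be traded for a regular representative. *)
Lemma Psi_congr (lam lam' : multiplier R T k) :
  (forall t s x a, reg_support Pobs x -> K_int Pobs b a ->
     lam t s x a = lam' t s x a) ->
  Psi Pobs tau b lam = Psi Pobs tau b lam'.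
Proof.
move=> ll'; apply: eq_integral => w /set_mem Ww; congr (sup _)%:E.
apply: eq_imagel => a Ka; apply: eq_bigr => t _.
by rewrite !ll'//; exact: reg_support_snd.
Qed.

Hypothesis W_compact : compact W.
Hypothesis T_ge1 : (1 <= T)%N.
Hypothesis tau01 : 0 < tau < 1.
Let lo := K_lo Pobs b.
Let hi := K_hi Pobs b.

Context (G : nat) (D : nat -> set 'M[R]_(T, k)).
Hypothesis D_meas : forall g, (g < G)%N -> measurable (D g : set (borel 'M[R]_(T, k))).

(* Clipping [a] to K_b makes a multiplier of the cone bounded on all of R. *)
Lemma cone_regular L kap (lam : multiplier R T k) :
  multiplier_cone Pobs b G D L kap lam -> exists (lam' : multiplier R T k) (M : R),
  [/\ forall t s, measurable_fun setT (fun p : borel condT => lam' t s p.1 p.2),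
      forall t s x, continuous (lam' t s x),
      forall t s x a, 0 <= lam' t s x a <= M &
      forall t s x a, reg_support Pobs x -> K_int Pobs b a ->
        lam t s x a = lam' t s x a].
Proof.
move=> [theta [theta0 lamE]].
have lohi : lo <= hi by exact: K_lo_le_hi b W_compact T_ge1.
pose phi l a := hat L kap l (clip lo hi a).
have cphi l : continuous (phi l).
  move=> a; apply: (@continuous_comp _ _ _ (clip lo hi) (hat L kap l)).
    exact: clip_continuous.
  exact: hat_continuous.
have /choice[N phiN] l : exists N, forall a, phi l a <= N.
  have : compact (hat L kap l @` `[lo, hi]%classic).
    apply: continuous_compact; last exact: segment_compact.
    by apply: continuous_subspaceT; exact: hat_continuous.
  move=> /compact_bounded[M [_ MP]]; exists (M + 1) => a.
  apply: le_trans (ler_norm _) _; apply: (MP (M + 1)); first by rewrite ltrDl.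
  by exists (clip lo hi a) => //=; rewrite in_itv/=; exact: clip_itv.
have N0 l : 0 <= N l by apply: le_trans (phiN l lo); exact: hat_ge0.
pose bnd t s := \sum_(g < G) \sum_(l < L.+1) theta t s g l * N l.
have bnd0 t s : 0 <= bnd t s.
  by apply: sumr_ge0 => g _; apply: sumr_ge0 => l _; rewrite mulr_ge0.
exists (fun t s x a => \sum_(g < G) \1_(D g) x * \sum_(l < L.+1) theta t s g l * phi l a),
  (\sum_(p : 'I_T * bool) bnd p.1 p.2); split.
- move=> t s; apply: measurable_sum => g; apply: measurable_funM.
    apply: (@measurableT_comp _ _ _ _ _ _ (\1_(D g) : borel 'M[R]_(T, k) -> R)).
      by apply: measurable_indic; exact: D_meas.
    by apply: continuous_borel_measurable => p; exact: cvg_fst.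
  apply: measurable_sum => l; apply: measurable_funM; first exact: measurable_cst.
  apply: continuous_real_measurable => p.
  by apply: (@continuous_comp _ _ _ snd (phi l)); [exact: cvg_snd|exact: cphi].
- move=> t s x; apply: (@continuous_sum _ _ _ _
    (fun g a => \1_(D (g : 'I_G)) x * \sum_(l < L.+1) theta t s g l * phi l a)) => g a.
  apply: cvgM; first exact: cvg_cst.
  apply: (@continuous_sum _ _ _ _ (fun (l : 'I_L.+1) a => theta t s g l * phi l a)) => l a'.
  by apply: cvgM; [exact: cvg_cst|exact: cphi].
- move=> t s x a; apply/andP; split.
    apply: sumr_ge0 => g _; rewrite mulr_ge0 ?indicE//.
    by apply: sumr_ge0 => l _; rewrite mulr_ge0// hat_ge0.
  rewrite (bigD1 (t, s))//= -[leLHS]addr0 lerD//; last by apply: sumr_ge0.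
  apply: ler_sum => g _; rewrite -[leRHS]mul1r ler_pM ?indicE//.
  + by apply: sumr_ge0 => l _; rewrite mulr_ge0// hat_ge0.
  + by case: (_ \in _); rewrite ?lexx ?ler01.
  + by apply: ler_sum => l _; rewrite ler_wpM2l.
- move=> t s x a rx Ka; rewrite lamE//; apply: eq_bigr => g _; congr (_ * _).
  by apply: eq_bigr => l _; rewrite /phi clip_id.
Qed.

End MultiplierCone.

(** Approximating a test multiplier uniformly moves [S_dual] by at most [eps], so [h + eps] is a
    majorant for the approximant in [F]. The function [v] stands for the maximum over K_b of the
    score of that approximant: it lies below every majorant and has nonnegative mean. *)
Lemma test_multiplier_dual_ge0 (R : realType) (T k : nat) (tau : R)
    (Pobs : probability (borel ('cV[R]_T * 'M[R]_(T, k))%type) R)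
    (b : 'cV[R]_k) (F : set (multiplier R T k)) :
  compact (obs_support Pobs) -> (1 <= T)%N -> 0 < tau < 1 ->
  (forall lam, F lam -> exists2 v : 'cV[R]_T * 'M[R]_(T, k) -> R,
     bounded_measurable (v : borel ('cV[R]_T * 'M[R]_(T, k))%type -> R) /\
     0 <= \int[Pobs]_w v w &
     forall w c, obs_support Pobs w ->
       (forall a, K_int Pobs b a -> S_dual tau b lam w a <= c) -> v w <= c) ->
  (forall f, cont_multiplier Pobs b f -> uniformly_approximable Pobs b F f) ->
  forall lam h, test_multiplier lam ->
  bounded_measurable (h : borel ('cV[R]_T * 'M[R]_(T, k))%type -> R) ->
  (forall w a, obs_support Pobs w -> K_int Pobs b a ->
     S_dual tau b lam w a <= h w) ->
  0 <= \int[Pobs]_w h w.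
Proof.
move=> W_compact T_ge1 tau01 F_ge0 F_dense lam h [clam [M lamM]] bh Sh.
apply/ler_addgt0Pl => eps e0; rewrite addrC.
(* There are [2 T] components, each multiplied in [S_dual] by a factor of absolute value at most
   1. *)
pose e := eps / (T%:R + T%:R).
have TT0 : 0 < T%:R + T%:R :> R by rewrite addr_gt0// ltr0n.
have e_gt0 : 0 < e by rewrite divr_gt0.
have clam' : cont_multiplier Pobs b lam.
  move=> t s; split; first by apply: continuous_subspaceT; exact: clam.
  by move=> x a _ _; case/andP: (lamM t s x a).
have [lam' Flam' ll'] := F_dense _ clam' _ e_gt0.
have [v [bv v0] vle] := F_ge0 _ Flam'.
have sumE : \sum_(t < T) (e + e) = eps.
  by rewrite sumr_const card_ord -mulr_natr mulrDl -mulrDr divfK// gt_eqF.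
apply: (le_trans v0); rewrite -[X in _ <= _ + X](Rintegral_prob_cst Pobs).
rewrite -Rintegral_bmD//; last exact: bounded_measurable_cst.
apply: le_Rintegral_bm_ae => //.
  by apply: bounded_measurableD => //; exact: bounded_measurable_cst.
have WW := law_support_ae (@separable_obs R T k) Pobs.
apply: (ae_imply WW) => w Ww; apply: (vle) => // a Ka.
rewrite -lerBlDl; apply: le_trans (_ : S_dual tau b lam' w a - S_dual tau b lam w a <= _).
  by rewrite lerB// Sh.
rewrite S_dualB -sumE; apply: le_trans (ler_norm _) _.
apply: (@S_dual_bound _ _ _ _ _ tau01 (fun t s x a => lam' t s x a - lam t s x a)) => t s.
by rewrite distrC; apply: ll' => //; exact: reg_support_snd.
Qed.

Theorem proposition6p7 (R : realType) (T k : nat)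
    (T_ge1 : (1 <= T)%N) (k_ge1 : (1 <= k)%N)
    (tau : R) (tau01 : 0 < tau < 1)
    (B : set 'cV[R]_k)
    (Pobs : probability (borel ('cV[R]_T * 'M[R]_(T, k))%type) R)
    (W_compact : compact (obs_support Pobs))
    (G : nat -> nat) (D : nat -> nat -> set 'M[R]_(T, k))
    (D_cells : forall Q, (1 <= Q)%N -> cells Pobs (G Q) (D Q))
    (L : nat -> 'cV[R]_k -> nat) (kap : nat -> 'cV[R]_k -> nat -> R)
    (kap_knots : forall Q b, (1 <= Q)%N -> B b ->
      knots (K_lo Pobs b) (K_hi Pobs b) (L Q b) (kap Q b)) :
  let Lam Q b := multiplier_cone Pobs b (G Q) (D Q) (L Q b) (kap Q b) in
  let Theta_I := identified_set Pobs tau B in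
  let Theta_dual Q := dual_set Pobs tau B (Lam Q) in
  (forall b, B b ->
     (forall Q, (1 <= Q)%N -> Lam Q b `<=` Lam Q.+1 b) /\
     (forall f, cont_multiplier Pobs b f ->
        uniformly_approximable Pobs b
          (\bigcup_(Q in [set Q | (1 <= Q)%N]) Lam Q b) f)) ->
  (forall Q, (1 <= Q)%N ->
     Theta_I `<=` Theta_dual Q.+1 /\ Theta_dual Q.+1 `<=` Theta_dual Q) /\
  Theta_I = \bigcap_(Q in [set Q | (1 <= Q)%N]) Theta_dual Q.
Proof.
move=> Lam Theta_I Theta_dual LamP.
have outer Q : (1 <= Q)%N -> Theta_I `<=` Theta_dual Q.
  move=> Q1 b [Bb [Ps adm]]; split => // lam Qlam.
  have [lam' [M [mlam clam lamM ll']]] :=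
    cone_regular W_compact T_ge1 (D_cells Q Q1).2 Qlam.
  rewrite (Psi_congr tau ll') (Psi_value b W_compact T_ge1 tau01 mlam clam lamM).
  by rewrite lee_fin (admissible_value_ge0 W_compact T_ge1 tau01 mlam clam lamM adm).
split.
  move=> Q Q1; split; first exact: outer.
  move=> b [Bb dual]; split => // lam Qlam; apply: dual.
  by apply: (LamP b Bb).1.
apply/seteqP; split=> b; first by move=> Ib Q Q1; exact: outer.
move=> Ib; have [Bb _] := Ib 1%N (leqnn 1); split => //.
(* The approximating family is the union of the cones over all Q, so an approximant may need any
   resolution; membership of [b] in every dual set covers it. *)
have dual_ge0 := @test_multiplier_dual_ge0 R T k tau Pobs b _ W_compact T_ge1
  tau01 _ (LamP b Bb).2.
have [|q [mq qP]] := dual_coupling W_compact T_ge1 tau01 (dual_ge0 _).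
  move=> lam [Q Q1 Qlam].
  have [lam' [M [mlam clam lamM ll']]] :=
    cone_regular W_compact T_ge1 (D_cells Q Q1).2 Qlam.
  (* On the support [lam] and [lam'] have the same scores over K_b, so this value lies below every
     majorant for [lam]. *)
  exists (value Pobs b tau lam').
    split; first exact: value_bounded_measurable mlam clam lamM.
    have [_ dual] := Ib Q Q1; have := dual lam Qlam.
    by rewrite (Psi_congr tau ll') (Psi_value b W_compact T_ge1 tau01 mlam clam lamM) lee_fin.
  move=> w c Ww Sc; apply: value_le => // a Ka.
  rewrite -[leLHS](_ : S_dual tau b lam w a = _); first exact: Sc.
  by apply: eq_bigr => t _; rewrite !ll'//; exact: reg_support_snd.
exact: admissible_law_of_coupling mq qP.
Qed.
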